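(* (i) Actions of a group $G$ by autoequivalences of a fusion category $\mathcal C$, up to an isomorphism, are in natural bijection with homotopy classes of mappings $BG\to B\underline{\mathrm{Eq}}(\mathcal C)$. (ii) Actions of a group $G$ by braided autoequivalences of a braided fusion category $\mathcal B$, up to an isomorphism, are in natural bijection with homotopy classes of mappings $BG\to B\underline{\mathrm{EqBr}}(\mathcal B)$.
   Context: Fusion categories are over an algebraically closed field of characteristic $0$. A categorical group is a monoidal groupoid whose objects are invertible. $\underline{\mathrm{Eq}}(\mathcal C)$ is the categorical group whose objects are tensor autoequivalences of $\mathcal C$ and whose morphisms are isomorphisms of such autoequivalences; $\underline{\mathrm{EqBr}}(\mathcal B)$ is the categorical group whose objects are braided autoequivalences of $\mathcal B$ and whose morphisms are isomorphisms of such autoequivalences. An action of $G$ by (braided) autoequivalences is an assignment $g\mapsto F_g$ attaching to every $g\in G$ a tensor (resp. braided) autoequivalence, together with functorial isomorphisms $\eta_{g,h}:F_g\circ F_h\to F_{gh}$ of tensor functors, $g,h\in G$, satisfying the 2-cocycle condition. $B$ denotes the classifying space (defined up to homotopy by the nerve construction) of a group or categorical group. *)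

(* Defs.v *)
From HB Require Import structures.
From mathcomp Require Import all_boot all_order all_algebra.
From Stdlib Require Import FunctionalExtensionality ProofIrrelevance IndefiniteDescription.
From Stdlib Require Import Relations.

Set Implicit Arguments.
Unset Strict Implicit.
Unset Printing Implicit Defensive.

Import GRing.Theory.
Local Open Scope ring_scope.

Declare Scope cat_scope.
Delimit Scope cat_scope with cat.

Record category := Category {
  cob :> Type;
  hom : cob -> cob -> Type;
  cid : forall x, hom x x;
  ccomp : forall x y z, hom y z -> hom x y -> hom x z;
  ccompA : forall x y z w (h : hom z w) (g : hom y z) (f : hom x y),
    ccomp h (ccomp g f) = ccomp (ccomp h g) f;
  ccomp1f : forall x y (f : hom x y), ccomp (cid y) f = f;
  ccompf1 : forall x y (f : hom x y), ccomp f (cid x) = f }.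

Arguments hom {_} _ _.
Arguments cid {_} _.
Arguments ccomp {_ _ _ _} _ _.

Notation "g ∘ f" := (ccomp g f) (at level 40, left associativity) : cat_scope.
Open Scope cat_scope.

Definition is_iso (C : category) (x y : C) (f : hom x y) : Prop :=
  exists g : hom y x, g ∘ f = cid x /\ f ∘ g = cid y.

Definition isomorphic (C : category) (x y : C) : Prop :=
  exists f : hom x y, is_iso f.

Definition mono (C : category) (x y : C) (f : hom x y) : Prop :=
  forall w (g h : hom w x), f ∘ g = f ∘ h -> g = h.

Definition epi (C : category) (x y : C) (f : hom x y) : Prop :=
  forall w (g h : hom y w), g ∘ f = h ∘ f -> g = h.

(** The equation [lun_run_unit] follows from the other axioms (Kelly); it is
    listed as in Mac Lane's definition. *)
Record moncat := MonCat {
  mcat :> category;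
  tob : mcat -> mcat -> mcat;
  thom : forall a b c d : mcat, hom a b -> hom c d -> hom (tob a c) (tob b d);
  tunit : mcat;
  ass : forall x y z : mcat, hom (tob (tob x y) z) (tob x (tob y z));
  lun : forall x : mcat, hom (tob tunit x) x;
  run : forall x : mcat, hom (tob x tunit) x;
  thom1 : forall x y : mcat, thom (cid x) (cid y) = cid (tob x y);
  thomM : forall (a b c a' b' c' : mcat) (g : hom b c) (f : hom a b)
    (g' : hom b' c') (f' : hom a' b'),
    thom (g ∘ f) (g' ∘ f') = thom g g' ∘ thom f f';
  ass_iso : forall x y z, is_iso (ass x y z);
  lun_iso : forall x, is_iso (lun x);
  run_iso : forall x, is_iso (run x);
  ass_nat : forall (a b c a' b' c' : mcat)
    (f : hom a a') (g : hom b b') (h : hom c c'),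
    ass a' b' c' ∘ thom (thom f g) h = thom f (thom g h) ∘ ass a b c;
  lun_nat : forall (x y : mcat) (f : hom x y),
    lun y ∘ thom (cid tunit) f = f ∘ lun x;
  run_nat : forall (x y : mcat) (f : hom x y),
    run y ∘ thom f (cid tunit) = f ∘ run x;
  pentagon : forall w x y z,
    ass w x (tob y z) ∘ ass (tob w x) y z
    = thom (cid w) (ass x y z) ∘ ass w (tob x y) z ∘ thom (ass w x y) (cid z);
  triangle : forall x y,
    thom (cid x) (lun y) ∘ ass x tunit y = thom (run x) (cid y);
  lun_run_unit : lun tunit = run tunit }.

Arguments tob {_} _ _.
Arguments thom {_ _ _ _ _} _ _.
Arguments tunit {_}.
Arguments ass {_} _ _ _.
Arguments lun {_} _.
Arguments run {_} _.

Notation "x ⊗ y" := (tob x y) (at level 35, right associativity) : cat_scope.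
Notation "f ⊠ g" := (thom f g) (at level 35, right associativity) : cat_scope.

Record functor (C D : category) := Functor {
  fob :> C -> D;
  fhom : forall x y, hom x y -> hom (fob x) (fob y);
  fhom1 : forall x, fhom (cid x) = cid (fob x);
  fhomM : forall x y z (g : hom y z) (f : hom x y),
    fhom (g ∘ f) = fhom g ∘ fhom f }.

Arguments fhom {_ _} _ {_ _} _.

Definition id_functor (C : category) : functor C C :=
  @Functor C C (fun x => x) (fun x y f => f)
    (fun x => erefl) (fun x y z g f => erefl).

Program Definition comp_functor (C D E : category) (F : functor D E) (G : functor C D) :
    functor C E :=
  @Functor C E (fun x => F (G x)) (fun x y f => fhom F (fhom G f)) _ _.
Next Obligation. by rewrite !fhom1. Qed.
Next Obligation. by rewrite !fhomM. Qed.

Definition nat_isomorphic (C D : category) (F G : functor C D) : Prop :=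
  exists e : forall x, hom (F x) (G x),
    (forall x, is_iso (e x)) /\
    (forall x y (f : hom x y), e y ∘ fhom F f = fhom G f ∘ e x).

Definition is_equivalence (C D : category) (F : functor C D) : Prop :=
  exists G : functor D C,
    nat_isomorphic (comp_functor G F) (id_functor C) /\
    nat_isomorphic (comp_functor F G) (id_functor D).

Record monfunctor (C D : moncat) := MonFunctor {
  mfun :> functor C D;
  mJ : forall x y : C, hom (mfun x ⊗ mfun y) (mfun (x ⊗ y));
  mu : hom tunit (mfun tunit);
  mJ_iso : forall x y, is_iso (mJ x y);
  mu_iso : is_iso mu;
  mJ_nat : forall (x y x' y' : C) (f : hom x x') (g : hom y y'),
    mJ x' y' ∘ (fhom mfun f ⊠ fhom mfun g) = fhom mfun (f ⊠ g) ∘ mJ x y;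
  mJ_ass : forall x y z : C,
    fhom mfun (ass x y z) ∘ mJ (x ⊗ y) z ∘ (mJ x y ⊠ cid (mfun z))
    = mJ x (y ⊗ z) ∘ (cid (mfun x) ⊠ mJ y z) ∘ ass (mfun x) (mfun y) (mfun z);
  mJ_lun : forall x : C,
    fhom mfun (lun x) ∘ mJ tunit x ∘ (mu ⊠ cid (mfun x)) = lun (mfun x);
  mJ_run : forall x : C,
    fhom mfun (run x) ∘ mJ x tunit ∘ (cid (mfun x) ⊠ mu) = run (mfun x) }.

Arguments mJ {_ _} _ _ _.
Arguments mu {_ _} _.

Record moniso (C D : moncat) (F G : monfunctor C D) := MonIso {
  mt :> forall x, hom (F x) (G x);
  mt_iso : forall x, is_iso (mt x);
  mt_nat : forall x y (f : hom x y), mt y ∘ fhom F f = fhom G f ∘ mt x;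
  mt_J : forall x y, mt (x ⊗ y) ∘ mJ F x y = mJ G x y ∘ (mt x ⊠ mt y);
  mt_u : mt tunit ∘ mu F = mu G }.

(** A [k]-linear structure with finite-dimensional Hom spaces: a [vectType]
    structure on every [hom x y], for which composition is bilinear. *)
Record linear_str (k : fieldType) (C : category) := LinearStr {
  hom_vect : forall x y : C, Vector.axioms_ k (hom x y);
  lhom : C -> C -> vectType k := fun x y => Vector.Pack (hom_vect x y);
  ccomp_linl : forall (x y z : C) (a : k) (g g' : lhom y z) (f : lhom x y),
    ((a *: g + g' : lhom y z) ∘ f : lhom x z)
    = a *: (g ∘ f : lhom x z) + (g' ∘ f : lhom x z);
  ccomp_linr : forall (x y z : C) (a : k) (g : lhom y z) (f f' : lhom x y),
    (g ∘ (a *: f + f' : lhom x y) : lhom x z)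
    = a *: (g ∘ f : lhom x z) + (g ∘ f' : lhom x z) }.

Section LinearNotions.
Variables (k : fieldType) (C : category) (L : linear_str k C).
Local Notation lhom := (lhom L).

Definition hzero (x y : C) : hom x y := (0 : lhom x y).

Definition is_zero_object (z : C) : Prop := cid z = hzero z z.

(** [x] is the direct sum of the [s i], with injections [inj] and projections
    [prj]. *)
Definition is_direct_sum n (s : 'I_n -> C) (x : C) : Prop :=
  exists (inj : forall i, hom (s i) x) (prj : forall i, hom x (s i)),
    [/\ forall i, prj i ∘ inj i = cid (s i),
        forall i j, i != j -> prj j ∘ inj i = hzero (s i) (s j)
      & \sum_i (inj i ∘ prj i : lhom x x) = cid x].

Definition is_kernel (x y w : C) (f : hom x y) (i : hom w x) : Prop :=
  f ∘ i = hzero w y /\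
  forall v (h : hom v x), f ∘ h = hzero v y -> exists! l : hom v w, i ∘ l = h.

Definition is_cokernel (x y w : C) (f : hom x y) (p : hom y w) : Prop :=
  p ∘ f = hzero x w /\
  forall v (h : hom y v), h ∘ f = hzero x v -> exists! l : hom w v, l ∘ p = h.

Definition abelian : Prop :=
  [/\ exists z : C, is_zero_object z,
      forall x y : C, exists s,
        is_direct_sum (fun i : 'I_2 => if i == ord0 then x else y) s,
      forall (x y : C) (f : hom x y),
        (exists w (i : hom w x), is_kernel f i) /\
        (exists w (p : hom y w), is_cokernel f p),
      forall (x y : C) (f : hom x y), mono f ->
        exists w (g : hom y w), is_kernel g f
    & forall (x y : C) (f : hom x y), epi f ->
        exists w (g : hom w x), is_cokernel g f].

Definition simple (x : C) : Prop :=
  ~ is_zero_object x /\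
  forall y (i : hom y x), mono i -> is_zero_object y \/ is_iso i.

Definition semisimple : Prop :=
  forall x : C, exists n (s : 'I_n -> C),
    (forall i, simple (s i)) /\ is_direct_sum s x.

Definition finitely_many_simples : Prop :=
  exists n (s : 'I_n -> C), forall x, simple x -> exists i, isomorphic x (s i).

End LinearNotions.

Definition is_inverse (C : category) (x y : C) (f : hom x y) (g : hom y x) : Prop :=
  g ∘ f = cid x /\ f ∘ g = cid y.

(** [y] is a left dual of [x] (and [x] a right dual of [y]). *)
Definition is_left_dual (M : moncat) (x y : M) : Prop :=
  exists (ev : hom (y ⊗ x) tunit) (coev : hom tunit (x ⊗ y)),
    run x ∘ (cid x ⊠ ev) ∘ ass x y x ∘ (coev ⊠ cid x) = lun x /\
    forall ai, is_inverse (ass y x y) ai ->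
      lun y ∘ (ev ⊠ cid y) ∘ ai ∘ (cid y ⊠ coev) = run y.

Definition rigid (M : moncat) : Prop :=
  forall x : M, (exists y, is_left_dual x y) /\ (exists y, is_left_dual y x).

Record fusion_cat (k : fieldType) := FusionCat {
  fus_mon :> moncat;
  fus_lin : linear_str k fus_mon;
  thom_linl : forall (a b c d : fus_mon) (t : k)
    (f f' : lhom fus_lin a b) (g : lhom fus_lin c d),
    ((t *: f + f' : lhom fus_lin a b) ⊠ g : lhom fus_lin (a ⊗ c) (b ⊗ d))
    = t *: (f ⊠ g : lhom fus_lin (a ⊗ c) (b ⊗ d))
      + (f' ⊠ g : lhom fus_lin (a ⊗ c) (b ⊗ d));
  thom_linr : forall (a b c d : fus_mon) (t : k)
    (f : lhom fus_lin a b) (g g' : lhom fus_lin c d),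
    (f ⊠ (t *: g + g' : lhom fus_lin c d) : lhom fus_lin (a ⊗ c) (b ⊗ d))
    = t *: (f ⊠ g : lhom fus_lin (a ⊗ c) (b ⊗ d))
      + (f ⊠ g' : lhom fus_lin (a ⊗ c) (b ⊗ d));
  fus_abelian : abelian fus_lin;
  fus_semisimple : semisimple fus_lin;
  fus_finite : finitely_many_simples fus_lin;
  fus_rigid : rigid fus_mon;
  fus_unit_simple : simple fus_lin tunit }.

Record braided_fusion_cat (k : fieldType) := BraidedFusionCat {
  bfus :> fusion_cat k;
  br : forall x y : bfus, hom (x ⊗ y) (y ⊗ x);
  br_iso : forall x y, is_iso (br x y);
  br_nat : forall (x y x' y' : bfus) (f : hom x x') (g : hom y y'),
    br x' y' ∘ (f ⊠ g) = (g ⊠ f) ∘ br x y;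
  hexagon1 : forall x y z : bfus,
    ass y z x ∘ br x (y ⊗ z) ∘ ass x y z
    = (cid y ⊠ br x z) ∘ ass y x z ∘ (br x y ⊠ cid z);
  hexagon2 : forall x y z : bfus, forall ai, is_inverse (ass x z y) ai ->
    br (x ⊗ y) z
    = ass z x y ∘ (br x z ⊠ cid y) ∘ ai ∘ (cid x ⊠ br y z) ∘ ass x y z }.

Arguments br {_ _} _ _.

Section Calculus.
Variable C : category.
Implicit Types x y z : C.

Lemma rwl x y z w (a : hom y z) (b : hom x y) (c : hom x z) :
  a ∘ b = c -> forall d : hom z w, d ∘ a ∘ b = d ∘ c.
Proof. by move=> <- d; rewrite -ccompA. Qed.

Lemma iso_epi x y z (f : hom x y) (g h : hom y z) :
  is_iso f -> g ∘ f = h ∘ f -> g = h.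
Proof.
move=> [i [_ fi]] e.
by rewrite -[g]ccompf1 -[h]ccompf1 -fi !ccompA e.
Qed.

Lemma iso_mono x y z (f : hom y z) (g h : hom x y) :
  is_iso f -> f ∘ g = f ∘ h -> g = h.
Proof.
move=> [i [fi _]] e.
by rewrite -[g]ccomp1f -[h]ccomp1f -fi -!ccompA e.
Qed.

Lemma cid_iso x : is_iso (cid x).
Proof. by exists (cid x); rewrite ccomp1f. Qed.

Lemma comp_iso x y z (g : hom y z) (f : hom x y) :
  is_iso g -> is_iso f -> is_iso (g ∘ f).
Proof.
move=> [i [gi ig]] [j [fj jf]]; exists (j ∘ i).
by rewrite !ccompA (rwl gi) ccompf1 fj (rwl jf) ccompf1 ig.
Qed.

Lemma iso_invE x y (f : hom x y) : is_iso f -> { g : hom y x | is_inverse f g }.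
Proof. exact: constructive_indefinite_description. Qed.

Lemma inverse_iso x y (f : hom x y) g : is_inverse f g -> is_iso g.
Proof. by move=> [a b]; exists f. Qed.

End Calculus.

Lemma thom_iso (M : moncat) (a b c d : M) (f : hom a b) (g : hom c d) :
  is_iso f -> is_iso g -> is_iso (f ⊠ g).
Proof.
move=> [f' [f1 f2]] [g' [g1 g2]]; exists (f' ⊠ g').
by rewrite -!thomM f1 f2 g1 g2 !thom1.
Qed.

Lemma fhom_iso (C D : category) (F : functor C D) (x y : C) (f : hom x y) :
  is_iso f -> is_iso (fhom F f).
Proof.
by move=> [g [a b]]; exists (fhom F g); rewrite -!fhomM a b !fhom1.
Qed.

Lemma moniso_eq (C D : moncat) (F G : monfunctor C D) (a b : moniso F G) :
  (forall x, a x = b x) -> a = b.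
Proof.
case: a => a a1 a2 a3 a4; case: b => b b1 b2 b3 b4 /= e.
have {}e : a = b by apply: functional_extensionality_dep.
subst b; f_equal; exact: proof_irrelevance.
Qed.

Local Obligation Tactic := intros; simpl.

Section MonFunctors.

Program Definition mfid (C : moncat) : monfunctor C C :=
  @MonFunctor C C (id_functor C) (fun x y => cid (x ⊗ y)) (cid tunit)
    _ _ _ _ _ _.
Next Obligation. exact: cid_iso. Qed.
Next Obligation. exact: cid_iso. Qed.
Next Obligation. by rewrite ccomp1f ccompf1. Qed.
Next Obligation. by rewrite thom1 !ccompf1 thom1 ccompf1 ccomp1f. Qed.
Next Obligation. by rewrite thom1 !ccompf1. Qed.
Next Obligation. by rewrite thom1 !ccompf1. Qed.

Program Definition mfcomp (C D E : moncat)
    (F : monfunctor D E) (G : monfunctor C D) : monfunctor C E :=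
  @MonFunctor C E (comp_functor F G)
    (fun x y => fhom F (mJ G x y) ∘ mJ F (G x) (G y))
    (fhom F (mu G) ∘ mu F) _ _ _ _ _ _.
Next Obligation.
apply: comp_iso; last exact: mJ_iso.
by apply: fhom_iso; apply: mJ_iso.
Qed.
Next Obligation.
apply: comp_iso; last exact: mu_iso.
by apply: fhom_iso; apply: mu_iso.
Qed.
Next Obligation.
by rewrite -ccompA mJ_nat !ccompA -!fhomM mJ_nat.
Qed.
Next Obligation.
rewrite -{1}[cid _]ccomp1f thomM -{1}[cid (F _)](fhom1 F) !ccompA.
rewrite -!ccompA (ccompA (mJ F _ _)) mJ_nat !ccompA -!fhomM.
rewrite mJ_ass !fhomM -!ccompA (ccompA (fhom F (ass _ _ _))) mJ_ass.
rewrite !ccompA; congr (_ ∘ _).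
rewrite -!ccompA; congr (_ ∘ _); rewrite ccompA -mJ_nat -!ccompA.
congr (_ ∘ _); rewrite fhom1.
by rewrite -thomM ccomp1f.
Qed.
Next Obligation.
rewrite -{1}[cid _]ccomp1f thomM -{1}[cid (F _)](fhom1 F) !ccompA.
rewrite -!ccompA (ccompA (mJ F _ _)) mJ_nat !ccompA -!fhomM mJ_lun.
exact: mJ_lun.
Qed.
Next Obligation.
rewrite -{1}[cid _]ccomp1f thomM -{1}[cid (F _)](fhom1 F) !ccompA.
rewrite -!ccompA (ccompA (mJ F _ _)) mJ_nat !ccompA -!fhomM mJ_run.
exact: mJ_run.
Qed.

Program Definition mi_id (C D : moncat) (F : monfunctor C D) : moniso F F :=
  @MonIso C D F F (fun x => cid (F x)) _ _ _ _.
Next Obligation. exact: cid_iso. Qed.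
Next Obligation. by rewrite ccomp1f ccompf1. Qed.
Next Obligation. by rewrite thom1 ccomp1f ccompf1. Qed.
Next Obligation. by rewrite ccomp1f. Qed.

Program Definition mi_comp (C D : moncat) (F G H : monfunctor C D)
    (b : moniso G H) (a : moniso F G) : moniso F H :=
  @MonIso C D F H (fun x => b x ∘ a x) _ _ _ _.
Next Obligation. by apply: comp_iso; apply: mt_iso. Qed.
Next Obligation. by rewrite -ccompA mt_nat !ccompA mt_nat. Qed.
Next Obligation. by rewrite -ccompA mt_J !ccompA mt_J thomM !ccompA. Qed.
Next Obligation. by rewrite -ccompA !mt_u. Qed.

Program Definition mi_hcomp (C D E : moncat) (F F' : monfunctor D E)
    (G G' : monfunctor C D) (b : moniso F F') (a : moniso G G') :
    moniso (mfcomp F G) (mfcomp F' G') :=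
  @MonIso C E (mfcomp F G) (mfcomp F' G') (fun x => b (G' x) ∘ fhom F (a x))
    _ _ _ _.
Next Obligation.
apply: comp_iso; first exact: mt_iso.
by apply: fhom_iso; apply: mt_iso.
Qed.
Next Obligation.
by rewrite -ccompA -fhomM (mt_nat a) fhomM !ccompA (mt_nat b).
Qed.
Next Obligation.
rewrite -!ccompA (ccompA (fhom F _)) -fhomM mt_J fhomM -!ccompA -mJ_nat.
rewrite !ccompA mt_nat thomM !ccompA; congr (_ ∘ _).
by rewrite -!ccompA mt_J.
Qed.
Next Obligation.
by rewrite -!ccompA (ccompA (fhom F _)) -fhomM mt_u ccompA mt_nat -ccompA mt_u.
Qed.

Program Definition mi_inv (C D : moncat) (F G : monfunctor C D)
    (a : moniso F G) : moniso G F :=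
  @MonIso C D G F (fun x => sval (iso_invE (mt_iso a x))) _ _ _ _.
Next Obligation. by case: iso_invE => g /= /inverse_iso. Qed.
Next Obligation.
case: iso_invE => g [g1 g2]; case: iso_invE => h [h1 h2] /=.
apply: (iso_mono (mt_iso a y)); rewrite !ccompA g2 ccomp1f mt_nat.
by rewrite (rwl h2) ccompf1.
Qed.
Next Obligation.
case: iso_invE => g [g1 g2]; case: iso_invE => h [h1 h2] /=.
case: iso_invE => l [l1 l2] /=.
apply: (iso_mono (mt_iso a (x ⊗ y))); rewrite !ccompA g2 ccomp1f mt_J.
by rewrite -ccompA -thomM h2 l2 thom1 ccompf1.
Qed.
Next Obligation.
case: iso_invE => g [g1 g2] /=.
by rewrite -(mt_u a) ccompA g1 ccomp1f.
Qed.

End MonFunctors.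

Section Quasi_inverse.
Variables C D : moncat.
Variable F : monfunctor C D.
Variable G : functor D C.
Variable d : forall x, hom (G (F x)) x.
Variable e : forall y, hom (F (G y)) y.
Hypothesis d_iso : forall x, is_iso (d x).
Hypothesis e_iso : forall y, is_iso (e y).
Hypothesis d_nat : forall x y (f : hom x y), d y ∘ fhom G (fhom F f) = f ∘ d x.
Hypothesis e_nat : forall x y (f : hom x y), e y ∘ fhom F (fhom G f) = f ∘ e x.

Lemma equiv_faithful x y (f g : hom x y) : fhom F f = fhom F g -> f = g.
Proof. by move=> eq; apply: (iso_epi (d_iso x)); rewrite -!d_nat eq. Qed.

Lemma equiv_full x y (h : hom (F x) (F y)) : { f : hom x y | fhom F f = h }.
Proof.
have [i [_ di]] := iso_invE (d_iso x).
exists (d y ∘ fhom G h ∘ i).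
set f := d y ∘ _ ∘ i.
have eG : fhom G (fhom F f) = fhom G h.
  apply: (iso_mono (d_iso y)); rewrite d_nat /f -ccompA.
  case: (d_iso x) => j [jd dj].
  have -> : i = j by rewrite -[i]ccomp1f -jd -ccompA di ccompf1.
  by rewrite jd ccompf1.
by apply: (iso_epi (e_iso _)); rewrite -!e_nat eG.
Qed.

Definition lift x y (h : hom (F x) (F y)) : hom x y := sval (equiv_full h).

Lemma liftE x y (h : hom (F x) (F y)) : fhom F (lift h) = h.
Proof. exact: (svalP (equiv_full h)). Qed.

Lemma lift_iso x y (h : hom x y) : is_iso (fhom F h) -> is_iso h.
Proof.
move=> [g [g1 g2]]; exists (lift g); split; apply: equiv_faithful;
by rewrite fhomM liftE fhom1.
Qed.

Definition qJ x y : hom (G x ⊗ G y) (G (x ⊗ y)) :=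
  lift (sval (iso_invE (e_iso (x ⊗ y))) ∘ (e x ⊠ e y)
        ∘ sval (iso_invE (mJ_iso F (G x) (G y)))).

Lemma qJE x y : e (x ⊗ y) ∘ fhom F (qJ x y) ∘ mJ F (G x) (G y) = e x ⊠ e y.
Proof.
rewrite /qJ liftE; case: iso_invE => g [g1 g2]; case: iso_invE => h [h1 h2] /=.
by rewrite !ccompA g2 ccomp1f -ccompA h1 ccompf1.
Qed.

Lemma qJE_l x y z (h : hom (x ⊗ y) z) :
  h ∘ e (x ⊗ y) ∘ fhom F (qJ x y) ∘ mJ F (G x) (G y) = h ∘ (e x ⊠ e y).
Proof. by rewrite -!ccompA (ccompA (e _)) qJE. Qed.

Definition qu : hom tunit (G tunit) :=
  lift (sval (iso_invE (e_iso tunit)) ∘ sval (iso_invE (mu_iso F))).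

Lemma quE : e tunit ∘ fhom F qu ∘ mu F = cid tunit.
Proof.
rewrite /qu liftE; case: iso_invE => g [g1 g2]; case: iso_invE => h [h1 h2] /=.
by rewrite !ccompA g2 ccomp1f h1.
Qed.

Lemma F_inj z w t (f g : hom z (G w)) (i : hom t (F z)) :
  is_iso i -> e w ∘ fhom F f ∘ i = e w ∘ fhom F g ∘ i -> f = g.
Proof.
move=> ii eq; apply: equiv_faithful; apply: (iso_mono (e_iso w)).
exact: (iso_epi ii).
Qed.

Program Definition qinv : monfunctor D C :=
  @MonFunctor D C G qJ qu _ _ _ _ _ _.
Next Obligation.
apply: lift_iso; rewrite liftE; case: iso_invE => g /= /inverse_iso gi.
case: iso_invE => h /= /inverse_iso hi.
by apply: comp_iso hi; apply: comp_iso => //; apply: thom_iso.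
Qed.
Next Obligation.
apply: lift_iso; rewrite liftE; case: iso_invE => g /= /inverse_iso gi.
case: iso_invE => h /= /inverse_iso hi.
exact: comp_iso.
Qed.
Next Obligation.
apply: (F_inj (mJ_iso F (G x) (G y))).
rewrite !fhomM !ccompA e_nat -(ccompA (f ⊠ g)) -(ccompA (f ⊠ g)) qJE.
rewrite -ccompA -mJ_nat ccompA qJE -!thomM.
by rewrite !e_nat.
Qed.
Next Obligation.
have ii : is_iso (mJ F (G x ⊗ G y) (G z) ∘ (mJ F (G x) (G y) ⊠ cid (F (G z)))).
  apply: comp_iso; first exact: mJ_iso.
  by apply: thom_iso; [exact: mJ_iso | exact: cid_iso].
apply: (F_inj ii).
rewrite !fhomM !ccompA e_nat.
rewrite -(ccompA _ (fhom F (qJ x y ⊠ _))) -mJ_nat !ccompA qJE_l.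
rewrite -!ccompA fhom1 -!thomM !ccompf1 (ccompA (e _)) qJE ass_nat.
rewrite (ccompA (fhom F (ass _ _ _))) mJ_ass !ccompA; congr (_ ∘ _).
rewrite -(ccompA _ (fhom F (cid _ ⊠ _))) -mJ_nat !ccompA qJE fhom1.
by rewrite -!thomM !ccompf1 qJE.
Qed.
Next Obligation.
have ii : is_iso (mJ F tunit (G x) ∘ (mu F ⊠ cid (F (G x)))).
  apply: comp_iso; first exact: mJ_iso.
  by apply: thom_iso; [exact: mu_iso | exact: cid_iso].
apply: (F_inj ii).
rewrite !fhomM !ccompA e_nat.
rewrite -(ccompA _ (fhom F (qu ⊠ _))) -mJ_nat !ccompA qJE_l.
rewrite -!ccompA -!thomM fhom1.
rewrite !ccompf1 (ccompA (e _)) quE lun_nat; congr (_ ∘ _).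
by rewrite ccompA mJ_lun.
Qed.
Next Obligation.
have ii : is_iso (mJ F (G x) tunit ∘ (cid (F (G x)) ⊠ mu F)).
  apply: comp_iso; first exact: mJ_iso.
  by apply: thom_iso; [exact: cid_iso | exact: mu_iso].
apply: (F_inj ii).
rewrite !fhomM !ccompA e_nat.
rewrite -(ccompA _ (fhom F (_ ⊠ qu))) -mJ_nat !ccompA qJE_l.
rewrite -!ccompA -!thomM fhom1.
rewrite !ccompf1 (ccompA (e _)) quE run_nat; congr (_ ∘ _).
by rewrite ccompA mJ_run.
Qed.

Program Definition qinvr : moniso (mfcomp F qinv) (mfid D) :=
  @MonIso D D (mfcomp F qinv) (mfid D) e e_iso _ _ _.
Next Obligation. exact: e_nat. Qed.
Next Obligation. by rewrite ccompA qJE ccomp1f. Qed.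
Next Obligation. by rewrite ccompA quE. Qed.

Program Definition qinvl : moniso (mfcomp qinv F) (mfid C) :=
  @MonIso C C (mfcomp qinv F) (mfid C) (fun x => lift (e (F x))) _ _ _ _.
Next Obligation. by apply: lift_iso; rewrite liftE. Qed.
Next Obligation. by apply: equiv_faithful; rewrite !fhomM !liftE e_nat. Qed.
Next Obligation.
apply: equiv_faithful; apply: (iso_epi (mJ_iso F _ _)).
rewrite !fhomM (liftE (e _)) fhom1 ccomp1f !ccompA e_nat -!ccompA.
by rewrite (ccompA (e _)) qJE -mJ_nat !liftE.
Qed.
Next Obligation.
apply: equiv_faithful; apply: (iso_epi (mu_iso F)).
rewrite !fhomM (liftE (e _)) fhom1 ccomp1f !ccompA e_nat -!ccompA.
by rewrite (ccompA (e _)) quE ccompf1.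
Qed.

End Quasi_inverse.

Record cat_group := CatGroup {
  cgmon :> moncat;
  cg_groupoid : forall (x y : cgmon) (f : hom x y), is_iso f;
  cg_invertible : forall x : cgmon, exists y : cgmon,
    isomorphic (x ⊗ y) tunit /\ isomorphic (y ⊗ x) tunit }.

Lemma is_equivalence_id (C : category) : is_equivalence (id_functor C).
Proof.
exists (id_functor C); split; exists (fun x => cid x); split=> x *;
by [exact: cid_iso | rewrite /= ccomp1f ccompf1].
Qed.

Lemma is_equivalence_comp (C D E : category) (F : functor D E) (G : functor C D) :
  is_equivalence F -> is_equivalence G -> is_equivalence (comp_functor F G).
Proof.
move=> [F' [[d [di dn]] [e [ei en]]]] [G' [[d' [di' dn']] [e' [ei' en']]]].
have dn2 x y (f : hom x y) : d' y ∘ fhom G' (fhom G f) = f ∘ d' x := dn' x y f.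
have en2 x y (f : hom x y) : e y ∘ fhom F (fhom F' f) = f ∘ e x := en x y f.
have dn1 x y (f : hom x y) : d y ∘ fhom F' (fhom F f) = f ∘ d x := dn x y f.
have en1 x y (f : hom x y) : e' y ∘ fhom G (fhom G' f) = f ∘ e' x := en' x y f.
exists (comp_functor G' F'); split.
  exists (fun x => d' x ∘ fhom G' (d (G x))); split=> [x|x y f] /=.
    by apply: comp_iso; [exact: di' | apply: fhom_iso; apply: di].
  by rewrite -ccompA -fhomM dn1 fhomM !ccompA dn2.
exists (fun x => e x ∘ fhom F (e' (F' x))); split=> [x|x y f] /=.
  by apply: comp_iso; [exact: ei | apply: fhom_iso; apply: ei'].
by rewrite -ccompA -fhomM en1 fhomM !ccompA en2.
Qed.

Section Strict.
Variables B C D E : moncat.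

Program Definition mi_ass (F : monfunctor D E) (G : monfunctor C D)
    (H : monfunctor B C) :
    moniso (mfcomp (mfcomp F G) H) (mfcomp F (mfcomp G H)) :=
  @MonIso B E (mfcomp (mfcomp F G) H) (mfcomp F (mfcomp G H))
    (fun x => cid (F (G (H x)))) _ _ _ _.
Next Obligation. exact: cid_iso. Qed.
Next Obligation. by rewrite ccomp1f ccompf1. Qed.
Next Obligation. by rewrite thom1 ccomp1f ccompf1 fhomM ccompA. Qed.
Next Obligation. by rewrite ccomp1f fhomM ccompA. Qed.

Program Definition mi_lun (F : monfunctor C D) : moniso (mfcomp (mfid D) F) F :=
  @MonIso C D (mfcomp (mfid D) F) F (fun x => cid (F x)) _ _ _ _.
Next Obligation. exact: cid_iso. Qed.
Next Obligation. by rewrite ccomp1f ccompf1. Qed.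
Next Obligation. by rewrite thom1 ccomp1f. Qed.
Next Obligation. by rewrite ccomp1f ccompf1. Qed.

Program Definition mi_run (F : monfunctor C D) : moniso (mfcomp F (mfid C)) F :=
  @MonIso C D (mfcomp F (mfid C)) F (fun x => cid (F x)) _ _ _ _.
Next Obligation. exact: cid_iso. Qed.
Next Obligation. by rewrite ccomp1f ccompf1. Qed.
Next Obligation. by rewrite thom1 fhom1 !ccomp1f ccompf1. Qed.
Next Obligation. by rewrite fhom1 !ccomp1f. Qed.

End Strict.

Section Autoequivalences.
Variables (M : moncat) (P : monfunctor M M -> Prop).
Hypothesis P_id : P (mfid M).
Hypothesis P_comp : forall F G, P F -> P G -> P (mfcomp F G).
Hypothesis P_inv : forall F G, P F -> is_equivalence F ->
  moniso (mfcomp F G) (mfid M) -> P G.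

Definition autoeq := { F : monfunctor M M | P F /\ is_equivalence F }.

Program Definition autoeq_cat : category :=
  @Category autoeq (fun F G => moniso (sval F) (sval G))
    (fun F => mi_id (sval F)) (fun F G H b a => mi_comp b a) _ _ _.
Next Obligation. by apply: moniso_eq => t /=; rewrite ccompA. Qed.
Next Obligation. by apply: moniso_eq => t /=; rewrite ccomp1f. Qed.
Next Obligation. by apply: moniso_eq => t /=; rewrite ccompf1. Qed.

Lemma autoeq_groupoid (F G : autoeq_cat) (a : hom F G) : is_iso a.
Proof.
exists (mi_inv a); split; apply: moniso_eq => t /=;
by case: iso_invE => g [].
Qed.

Definition autoeq_id : autoeq_cat :=
  exist (fun F => P F /\ is_equivalence F) (mfid M) (conj P_id (is_equivalence_id M)).

Definition autoeq_comp (F G : autoeq_cat) : autoeq_cat :=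
  exist (fun F => P F /\ is_equivalence F) (mfcomp (sval F) (sval G))
    (conj (P_comp (proj1 (svalP F)) (proj1 (svalP G)))
          (is_equivalence_comp (proj2 (svalP F)) (proj2 (svalP G)))).

Program Definition autoeq_mon : moncat :=
  @MonCat autoeq_cat autoeq_comp (fun _ _ _ _ b a => mi_hcomp b a) autoeq_id
    (fun F G H => mi_ass (sval F) (sval G) (sval H))
    (fun F => mi_lun (sval F)) (fun F => mi_run (sval F))
    _ _ _ _ _ _ _ _ _ _ _.
Next Obligation. by apply: moniso_eq => t /=; rewrite fhom1 ccomp1f. Qed.
Next Obligation.
apply: moniso_eq => t /=; rewrite fhomM -!ccompA; congr (_ ∘ _).
by rewrite !ccompA mt_nat.
Qed.
Next Obligation. exact: autoeq_groupoid. Qed.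
Next Obligation. exact: autoeq_groupoid. Qed.
Next Obligation. exact: autoeq_groupoid. Qed.
Next Obligation.
by apply: moniso_eq => t /=; rewrite ccomp1f ccompf1 fhomM ccompA.
Qed.
Next Obligation. by apply: moniso_eq => t /=; rewrite !ccomp1f ccompf1. Qed.
Next Obligation.
by apply: moniso_eq => t /=; rewrite fhom1 !ccomp1f !ccompf1.
Qed.
Next Obligation. by apply: moniso_eq => t /=; rewrite !fhom1 !ccomp1f. Qed.
Next Obligation. by apply: moniso_eq => t /=; rewrite !fhom1 !ccomp1f. Qed.
Next Obligation. exact: moniso_eq. Qed.

Lemma autoeq_invertible (F : autoeq_mon) : exists G : autoeq_mon,
  isomorphic (F ⊗ G) tunit /\ isomorphic (G ⊗ F) tunit.
Proof.
case: F => F [PF FE]; have [G [[d [di dn]] [e [ei en]]]] := FE.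
have PG : P (qinv di ei dn en) by apply: P_inv FE _ => //; exact: qinvr.
have GE : is_equivalence (qinv di ei dn en).
  by exists F; split; [exists e | exists d].
exists (exist (fun F => P F /\ is_equivalence F) _ (conj PG GE)); split.
  by exists (qinvr di ei dn en); exact: autoeq_groupoid.
by exists (qinvl di ei dn en); exact: autoeq_groupoid.
Qed.

Definition autoeq_group : cat_group :=
  @CatGroup autoeq_mon autoeq_groupoid autoeq_invertible.

End Autoequivalences.

Section Fusion_autoequivalences.
Variable k : fieldType.

Definition is_linear (C : fusion_cat k) (F : functor C C) : Prop :=
  forall (x y : C) (a : k) (f g : lhom (fus_lin C) x y),
    fhom F (a *: f + g : lhom (fus_lin C) x y)
    = a *: (fhom F f : lhom (fus_lin C) (F x) (F y))
      + (fhom F g : lhom (fus_lin C) (F x) (F y)).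

Definition is_braided (B : braided_fusion_cat k) (F : monfunctor B B) : Prop :=
  forall x y : B, fhom F (br x y) ∘ mJ F x y = mJ F y x ∘ br (F x) (F y).

Lemma is_linear_id (C : fusion_cat k) : is_linear (mfid C).
Proof. by []. Qed.

Lemma is_linear_comp (C : fusion_cat k) (F G : monfunctor C C) :
  is_linear F -> is_linear G -> is_linear (mfcomp F G).
Proof. by move=> lF lG x y a f g /=; rewrite lG lF. Qed.

Lemma is_linear_inv (C : fusion_cat k) (F G : monfunctor C C) :
  is_linear F -> is_equivalence F -> moniso (mfcomp F G) (mfid C) -> is_linear G.
Proof.
move=> lF [F' [[d [di dn]] _]] e x y a f g.
apply: (equiv_faithful (G := F') di dn).
apply: (iso_mono (mt_iso e y)).
have E (h : hom x y) : e y ∘ fhom F (fhom G h) = h ∘ e x := mt_nat e h.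
rewrite lF E [RHS](ccomp_linr (l := fus_lin C)).
rewrite [LHS](ccomp_linl (l := fus_lin C)).
by congr (a *: (_ : lhom _ _ _) + (_ : lhom _ _ _)).
Qed.

Lemma is_braided_id (B : braided_fusion_cat k) : is_braided (mfid B).
Proof. by move=> x y; rewrite /= ccomp1f ccompf1. Qed.

Lemma is_braided_comp (B : braided_fusion_cat k) (F G : monfunctor B B) :
  is_braided F -> is_braided G -> is_braided (mfcomp F G).
Proof.
move=> bF bG x y /=.
by rewrite ccompA -fhomM bG fhomM -!ccompA bF.
Qed.

Lemma is_braided_inv (B : braided_fusion_cat k) (F G : monfunctor B B) :
  is_braided F -> is_equivalence F -> moniso (mfcomp F G) (mfid B) ->
  is_braided G.
Proof.
move=> bF [F' [[d [di dn]] _]] e x y.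
apply: (equiv_faithful (G := F') di dn).
apply: (iso_mono (mt_iso e _)); apply: (iso_epi (mJ_iso F _ _)).
have eJ a b : e (a ⊗ b) ∘ (fhom F (mJ G a b) ∘ mJ F (G a) (G b)) = e a ⊠ e b.
  by rewrite [LHS](mt_J e a b) /= ccomp1f.
have E (h : hom (x ⊗ y) (y ⊗ x)) : e _ ∘ fhom F (fhom G h) = h ∘ e _ := mt_nat e h.
rewrite !fhomM !ccompA E -!ccompA eJ.
by rewrite br_nat -eJ -!ccompA bF.
Qed.

Definition Eq (C : fusion_cat k) : cat_group :=
  autoeq_group (@is_linear_id C) (@is_linear_comp C) (@is_linear_inv C).

Lemma is_linear_braided_id (B : braided_fusion_cat k) :
  is_linear (mfid B) /\ is_braided (mfid B).
Proof. by split; [exact: is_linear_id | exact: is_braided_id]. Qed.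

Lemma is_linear_braided_comp (B : braided_fusion_cat k) (F G : monfunctor B B) :
  is_linear F /\ is_braided F -> is_linear G /\ is_braided G ->
  is_linear (mfcomp F G) /\ is_braided (mfcomp F G).
Proof.
by move=> [lF bF] [lG bG]; split; [exact: is_linear_comp | exact: is_braided_comp].
Qed.

Lemma is_linear_braided_inv (B : braided_fusion_cat k) (F G : monfunctor B B) :
  is_linear F /\ is_braided F -> is_equivalence F ->
  moniso (mfcomp F G) (mfid B) -> is_linear G /\ is_braided G.
Proof.
by move=> [lF bF] eF e; split; [exact: is_linear_inv e | exact: is_braided_inv e].
Qed.

Definition EqBr (B : braided_fusion_cat k) : cat_group :=
  autoeq_group (@is_linear_braided_id B) (@is_linear_braided_comp B)
    (@is_linear_braided_inv B).

End Fusion_autoequivalences.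

Section Discrete.
Variable G : groupType.
Local Open Scope group_scope.

Program Definition discrete_cat : category :=
  @Category G (fun x y => x = y) (fun x => erefl)
    (fun x y z e' e => etrans e e') _ _ _.
Next Obligation. exact: proof_irrelevance. Qed.
Next Obligation. exact: proof_irrelevance. Qed.
Next Obligation. exact: proof_irrelevance. Qed.

Lemma discrete_hom (x y : discrete_cat) (e e' : hom x y) : e = e'.
Proof. exact: (@proof_irrelevance (x = y) e e'). Qed.

Lemma discrete_iso (x y : discrete_cat) (e : hom x y) : is_iso e.
Proof. by exists (esym e); split; apply: discrete_hom. Qed.

Program Definition discrete_mon : moncat :=
  @MonCat discrete_cat (fun x y => x * y) (fun _ _ _ _ e e' => f_equal2 _ e e') 1
    (fun x y z => esym (mulgA x y z)) (@mul1g G) (@mulg1 G) _ _ _ _ _ _ _ _ _ _ _.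
Next Obligation. exact: discrete_hom. Qed.
Next Obligation. exact: discrete_hom. Qed.
Next Obligation. exact: discrete_iso. Qed.
Next Obligation. exact: discrete_iso. Qed.
Next Obligation. exact: discrete_iso. Qed.
Next Obligation. exact: discrete_hom. Qed.
Next Obligation. exact: discrete_hom. Qed.
Next Obligation. exact: discrete_hom. Qed.
Next Obligation. exact: discrete_hom. Qed.
Next Obligation. exact: discrete_hom. Qed.
Next Obligation. exact: discrete_hom. Qed.

Lemma discrete_invertible (x : discrete_mon) : exists y : discrete_mon,
  isomorphic (x ⊗ y) tunit /\ isomorphic (y ⊗ x) tunit.
Proof.
exists (x^-1 : G).
by split; [exists (mulgV x) | exists (mulVg x)]; apply: discrete_iso.
Qed.

Definition discrete : cat_group :=
  @CatGroup discrete_mon discrete_iso discrete_invertible.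

End Discrete.

Record ordmap (m n : nat) := OrdMap {
  om :> 'I_m.+1 -> 'I_n.+1;
  om_le : forall i j : 'I_m.+1, (i <= j)%N -> (om i <= om j)%N }.

Definition om_id n : ordmap n n := @OrdMap n n (fun i => i) (fun i j h => h).

Definition om_comp m n p (b : ordmap n p) (a : ordmap m n) : ordmap m p :=
  @OrdMap m p (fun i => b (a i)) (fun i j h => om_le b (om_le a h)).

Definition om_const m n (i : 'I_n.+1) : ordmap m n :=
  @OrdMap m n (fun=> i) (fun _ _ _ => leqnn i).

Lemma om_eq m n (a b : ordmap m n) : a =1 b -> a = b.
Proof.
case: a => a ha; case: b => b hb /= e.
have {}e : a = b by apply: functional_extensionality.
by subst b; f_equal; apply: proof_irrelevance.
Qed.

Record sset := SSet {
  sx :> nat -> Type;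
  sop : forall m n, ordmap m n -> sx n -> sx m;
  sop_id : forall n (x : sx n), sop (om_id n) x = x;
  sop_comp : forall m n p (b : ordmap n p) (a : ordmap m n) (x : sx p),
    sop (om_comp b a) x = sop a (sop b x) }.

Arguments sop {_ _ _} _ _.

Record smap (X Y : sset) := SMap {
  sm :> forall n, X n -> Y n;
  sm_nat : forall m n (a : ordmap m n) (x : X n), sm (sop a x) = sop a (sm x) }.

Arguments sm {_ _} _ {_} _.

Program Definition smap_comp (X Y Z : sset) (g : smap Y Z) (f : smap X Y) :
    smap X Z :=
  @SMap X Z (fun n x => g n (f n x)) _.
Next Obligation. by rewrite !sm_nat. Qed.

Program Definition sprod (X Y : sset) : sset :=
  @SSet (fun n => (X n * Y n)%type) (fun m n a x => (sop a x.1, sop a x.2)) _ _.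
Next Obligation. by rewrite !sop_id -surjective_pairing. Qed.
Next Obligation. by rewrite !sop_comp. Qed.

Program Definition std_simplex (d : nat) : sset :=
  @SSet (fun n => ordmap n d) (fun m n a x => om_comp x a) _ _.
Next Obligation. exact: om_eq. Qed.
Next Obligation. exact: om_eq. Qed.

Definition homotopy_between (X Y : sset) (f g : smap X Y)
    (h : smap (sprod X (std_simplex 1)) Y) : Prop :=
  forall n (x : X n),
    sm h (x, om_const n ord0) = sm f x /\ sm h (x, om_const n ord_max) = sm g x.

(** Spaces are modelled by simplicial sets. The nerves of categorical groups
    defined below are Kan complexes, so homotopy classes of simplicial maps into
    them are the homotopy classes of maps between the geometric realizations.
    For a Kan target, simplicial homotopy is already an equivalence relation;
    the closure makes the definition meaningful for any [Y]. *)
Definition homotopic (X Y : sset) : relation (smap X Y) :=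
  clos_refl_sym_trans _ (fun f g => exists h, homotopy_between f g h).

Record psset := PSSet { psx :> sset; pt : psx 0 }.

Definition ptn (X : psset) n : X n := sop (om_const n ord0) (pt X).

Record pmap (X Y : psset) := PMap {
  pm :> smap X Y;
  pm_pt : pm 0%N (pt X) = pt Y }.

Definition phomotopic (X Y : psset) : relation (pmap X Y) :=
  clos_refl_sym_trans _ (fun f g => exists h,
    homotopy_between f g h /\
    forall n (t : std_simplex 1 n), sm h (ptn X n, t) = ptn Y n).

(** The geometric nerve of a categorical group [A], regarded as a bicategory
    with one object: an [n]-simplex is a lax (hence pseudo) functor from the
    ordered set [{0 < ... < n}]. It assigns an object [X_ij] to [i <= j], a
    morphism [X_ij ⊗ X_jl -> X_il] to [i <= j <= l], and a unit constraint
    [1 -> X_ii] to [i]. *)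
Section Nerve.
Variable A : cat_group.

Record nerve_simplex n := NerveSimplex {
  nX : forall i j : 'I_n.+1, (i <= j)%N -> A;
  nT : forall (i j l : 'I_n.+1)
    (ij : (i <= j)%N) (jl : (j <= l)%N) (il : (i <= l)%N),
    hom (nX ij ⊗ nX jl) (nX il);
  nU : forall (i : 'I_n.+1) (ii : (i <= i)%N), hom tunit (nX ii);
  n_assoc : forall (i j l m : 'I_n.+1)
    (ij : (i <= j)%N) (jl : (j <= l)%N) (lm : (l <= m)%N)
    (il : (i <= l)%N) (jm : (j <= m)%N) (im : (i <= m)%N),
    nT il lm im ∘ (nT ij jl il ⊠ cid (nX lm))
    = nT ij jm im ∘ (cid (nX ij) ⊠ nT jl lm jm) ∘ ass (nX ij) (nX jl) (nX lm);
  n_unitl : forall (i j : 'I_n.+1) (ii : (i <= i)%N) (ij : (i <= j)%N),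
    nT ii ij ij ∘ (nU ii ⊠ cid (nX ij)) = lun (nX ij);
  n_unitr : forall (i j : 'I_n.+1) (ij : (i <= j)%N) (jj : (j <= j)%N),
    nT ij jj ij ∘ (cid (nX ij) ⊠ nU jj) = run (nX ij) }.

Definition nerve_op m n (a : ordmap m n) (s : nerve_simplex n) : nerve_simplex m :=
  @NerveSimplex m
    (fun i j ij => nX s (om_le a ij))
    (fun i j l ij jl il => nT s (om_le a ij) (om_le a jl) (om_le a il))
    (fun i ii => nU s (om_le a ii))
    (fun i j l m ij jl lm il jm im =>
       n_assoc s (om_le a ij) (om_le a jl) (om_le a lm)
                 (om_le a il) (om_le a jm) (om_le a im))
    (fun i j ii ij => n_unitl s (om_le a ii) (om_le a ij))
    (fun i j ij jj => n_unitr s (om_le a ij) (om_le a jj)).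

Program Definition nerve : sset := @SSet nerve_simplex nerve_op _ _.
Next Obligation. by case: x. Qed.
Next Obligation. by []. Qed.

Program Definition nerve_pt : nerve_simplex 0 :=
  @NerveSimplex 0 (fun _ _ _ => tunit) (fun _ _ _ _ _ _ => lun tunit)
    (fun _ _ => cid tunit) _ _ _.
Next Obligation. by rewrite -ccompA triangle -lun_run_unit. Qed.
Next Obligation. by rewrite thom1 ccompf1. Qed.
Next Obligation. by rewrite thom1 ccompf1 lun_run_unit. Qed.

Definition classifying_space : psset := @PSSet nerve nerve_pt.

End Nerve.

Notation Bcg := classifying_space.
Notation BG G := (classifying_space (discrete G)).

Section Idto.
Variable M : moncat.

Definition idto (x y : M) (e : x = y) : hom x y :=
  match e in _ = z return hom x z with erefl => cid x end.

Lemma idto_id (x : M) (e : x = x) : idto e = cid x.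
Proof. by rewrite (proof_irrelevance _ e erefl). Qed.

Lemma idto_comp (x y z : M) (e : x = y) (e' : y = z) :
  idto e' ∘ idto e = idto (etrans e e').
Proof. by case: z / e'; rewrite ccomp1f. Qed.

Lemma idto_thom (x y x' y' : M) (e : x = y) (e' : x' = y') :
  idto e ⊠ idto e' = idto (f_equal2 (@tob M) e e').
Proof. by destruct e, e'; rewrite thom1 idto_id. Qed.

Lemma idto_irr (x y : M) (e e' : x = y) : idto e = idto e'.
Proof. by rewrite (proof_irrelevance _ e e'). Qed.

Lemma idto_ass (x y z x' y' z' : M) (e : x = x') (e' : y = y') (e'' : z = z') :
  ass x' y' z' ∘ ((idto e ⊠ idto e') ⊠ idto e'')
  = (idto e ⊠ (idto e' ⊠ idto e'')) ∘ ass x y z.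
Proof. exact: ass_nat. Qed.

End Idto.

(** Taking [A] to be [Eq C], this is an action of [G] by autoequivalences of [C]:
    autoequivalences [F_g] and isomorphisms of tensor functors
    [η_{g,h} : F_g ∘ F_h -> F_{gh}] satisfying the 2-cocycle condition. The
    identity morphism [idto _] identifies [F_{g(hl)}] and [F_{(gh)l}]. *)
Record action (G : groupType) (A : cat_group) := Action {
  aF : G -> A;
  aη : forall g h : G, hom (aF g ⊗ aF h) (aF (g * h)%g);
  a_cocycle : forall g h l : G,
    idto (f_equal aF (mulgA g h l)) ∘ aη g (h * l)%g ∘ (cid (aF g) ⊠ aη h l)
      ∘ ass (aF g) (aF h) (aF l)
    = aη (g * h)%g l ∘ (aη g h ⊠ cid (aF l)) }.

Section Action_isomorphisms.
Variables (G : groupType) (A : cat_group).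

Definition action_iso (a b : action G A) : Prop :=
  exists α : forall g, hom (aF a g) (aF b g),
    forall g h, α (g * h)%g ∘ aη a g h = aη b g h ∘ (α g ⊠ α h).

(** An object [P] with isomorphisms [P ⊗ F_g -> F'_g ⊗ P] compatible with [η]
    and [η']. For [A = Eq C]: an isomorphism from the category [C] with the action
    [F] to the category [C] with the action [F']. *)
Definition action_conj (a b : action G A) : Prop :=
  exists (P : A) (β : forall g, hom (P ⊗ aF a g) (aF b g ⊗ P)),
    forall g h, forall ai, is_inverse (ass (aF b g) (aF b h) P) ai ->
      β (g * h)%g ∘ (cid P ⊠ aη a g h) ∘ ass P (aF a g) (aF a h)
      = (aη b g h ⊠ cid P) ∘ ai ∘ (cid (aF b g) ⊠ β h)
        ∘ ass (aF b g) P (aF a h) ∘ (β g ⊠ cid (aF a h)).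

End Action_isomorphisms.

Lemma aη_castl (G : groupType) (A : cat_group) (a : action G A) (g g' h : G)
    (e : g = g') (E : aF a g = aF a g') (E' : aF a (g * h)%g = aF a (g' * h)%g) :
  aη a g' h ∘ (idto E ⊠ cid _) = idto E' ∘ aη a g h.
Proof. by subst g'; rewrite !idto_id thom1 ccomp1f ccompf1. Qed.

Lemma aη_castr (G : groupType) (A : cat_group) (a : action G A) (g h h' : G)
    (e : h = h') (E : aF a h = aF a h') (E' : aF a (g * h)%g = aF a (g * h')%g) :
  aη a g h' ∘ (cid _ ⊠ idto E) = idto E' ∘ aη a g h.
Proof. by subst h'; rewrite !idto_id thom1 ccomp1f ccompf1. Qed.

Program Definition action_pull (G H : groupType) (A : cat_group)
    (f : {multiplicative H -> G}) (a : action G A) : action H A :=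
  @Action H A (fun h => aF a (f h))
    (fun g h => idto (f_equal (aF a) (esym (gmulfM (s := f) g h))) ∘ aη a (f g) (f h)) _.
Next Obligation.
pose e x y : aF a (f x * f y)%g = aF a (f (x * y)%g) :=
  f_equal (aF a) (esym (gmulfM (s := f) x y)).
have eL x y z : (aη a (f x * f y) (f z))%g ∘ (aη a (f x) (f y) ⊠ cid _) =
    idto (f_equal (aF a) (mulgA (f x) (f y) (f z))) ∘ aη a (f x) (f y * f z)%g
    ∘ (cid _ ⊠ aη a (f y) (f z)) ∘ ass _ _ _ by rewrite a_cocycle.
have E1 : aF a (f g * f (h * l))%g = aF a (f g * (f h * f l))%g by rewrite gmulfM.
have E2 : aF a (f g * f h * f l)%g = aF a (f (g * h) * f l)%g by rewrite gmulfM.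
have -> : cid (aF a (f g)) ⊠ (idto (e h l) ∘ aη a (f h) (f l))
    = (cid _ ⊠ idto (e h l)) ∘ (cid _ ⊠ aη a (f h) (f l)).
  by rewrite -thomM ccomp1f.
have -> : (idto (e g h) ∘ aη a (f g) (f h)) ⊠ cid (aF a (f l))
    = (idto (e g h) ⊠ cid _) ∘ (aη a (f g) (f h) ⊠ cid _).
  by rewrite -thomM ccomp1f.
rewrite !ccompA -[in LHS](ccompA _ _ (cid _ ⊠ idto _)) (aη_castr (esym (gmulfM h l)) (e h l) (esym E1)).
rewrite -[in RHS](ccompA _ _ (idto _ ⊠ cid _)) (aη_castl (esym (gmulfM g h)) (e g h) E2).
rewrite -[RHS]ccompA -[in RHS](ccompA (idto E2)) eL !ccompA !idto_comp.
by congr (_ ∘ _ ∘ _ ∘ _); apply: idto_irr.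
Qed.

Section Group_nerve.
Variable G : groupType.
Local Open Scope group_scope.

Lemma gnerve_eq n (s t : BG G n) :
  (forall (i j : 'I_n.+1) (ij : (i <= j)%N), nX s ij = nX t ij) -> s = t.
Proof.
case: s => X T U a1 a2 a3; case: t => X' T' U' b1 b2 b3 /= e.
have {}e : X = X'.
  apply: functional_extensionality_dep => i.
  apply: functional_extensionality_dep => j.
  by apply: functional_extensionality_dep => ij; apply: e.
subst X'.
have e : T = T'.
  by do 6! apply: functional_extensionality_dep => ?; apply: discrete_hom.
subst T'.
have e : U = U'.
  by do 2! apply: functional_extensionality_dep => ?; apply: discrete_hom.
by subst U'; f_equal; apply: proof_irrelevance.
Qed.

(** The simplex of [BG] with edges [v_i^-1 v_j]. *)
Program Definition gsimplex n (v : 'I_n.+1 -> G) : BG G n :=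
  @NerveSimplex (discrete G) n (fun i j _ => (v i)^-1 * v j)
    (fun i j l _ _ _ => _) (fun i _ => esym (mulVg (v i))) _ _ _.
Next Obligation. by rewrite mulgA mulgK. Qed.
Next Obligation. exact: discrete_hom. Qed.
Next Obligation. exact: discrete_hom. Qed.
Next Obligation. exact: discrete_hom. Qed.

Lemma gnerve_diag n (s : BG G n) (i : 'I_n.+1) (ii : (i <= i)%N) : nX s ii = 1.
Proof. exact: esym (nU s ii). Qed.

Lemma gnerve_mul n (s : BG G n) (i j l : 'I_n.+1) (ij : (i <= j)%N) (jl : (j <= l)%N)
  (il : (i <= l)%N) : nX s ij * nX s jl = nX s il.
Proof. exact: (nT s ij jl il). Qed.

End Group_nerve.

Section Bmap.
Variables (H G : groupType) (f : {multiplicative H -> G}).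
Local Open Scope group_scope.

Lemma multiplicative1 : f 1 = 1.
Proof. by apply: (@mulgI _ (f 1)); rewrite -gmulfM !mulg1. Qed.

Program Definition Bhom_simplex n (s : BG H n) : BG G n :=
  @NerveSimplex (discrete G) n (fun i j ij => f (nX s ij))
    (fun i j l ij jl il => _) (fun i ii => _) _ _ _.
Next Obligation. by rewrite -gmulfM gnerve_mul. Qed.
Next Obligation. by rewrite gnerve_diag multiplicative1. Qed.
Next Obligation. exact: discrete_hom. Qed.
Next Obligation. exact: discrete_hom. Qed.
Next Obligation. exact: discrete_hom. Qed.

Program Definition Bhom_map : smap (BG H) (BG G) := @SMap _ _ Bhom_simplex _.
Next Obligation. exact: gnerve_eq. Qed.

Program Definition Bhom : pmap (BG H) (BG G) := @PMap _ _ Bhom_map _.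
Next Obligation. by apply: gnerve_eq => i j ij; exact: multiplicative1. Qed.

End Bmap.

Program Definition pmap_comp (X Y Z : psset) (g : pmap Y Z) (f : pmap X Y) :
    pmap X Z :=
  @PMap X Z (smap_comp g f) _.
Next Obligation. by rewrite !pm_pt. Qed.

(** The action underlying a map [φ : BG -> BA]: the object [F_g] is the value of
    [φ] on the edge [g], and [η_{g,h}] is its value on the triangle with edges
    [g], [h], [gh]; [map_obj] says that the edges of that triangle are the
    chosen objects. *)
Section Action_of_map.
Variables (G : groupType) (A : cat_group) (φ : smap (BG G) (Bcg A)).
Local Open Scope group_scope.

Definition gedge (g : G) : BG G 1%N :=
  gsimplex (fun i : 'I_2 => nth 1 [:: 1; g] i).

Definition gtriangle (g h : G) : BG G 2%N :=
  gsimplex (fun i : 'I_3 => nth 1 [:: 1; g; g * h] i).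

Definition gtetra (g h l : G) : BG G 3%N :=
  gsimplex (fun i : 'I_4 => nth 1 [:: 1; g; g * h; g * h * l] i).

Definition i01 : ((@ord0 1%N : nat) <= (@ord_max 1%N : nat))%N := isT.

Definition map_ob (g : G) : A := nX (sm φ (gedge g)) i01.

Definition edge_fun n (i j : 'I_n.+1) (t : 'I_2) : 'I_n.+1 :=
  if val t is 0%N then i else j.

Lemma edge_fun_le n (i j : 'I_n.+1) (ij : (i <= j)%N) (s t : 'I_2) :
  (s <= t)%N -> (edge_fun i j s <= edge_fun i j t)%N.
Proof. by move: s t => [[|[|s]] hs] [[|[|t]] ht]. Qed.

Definition om_edge n (i j : 'I_n.+1) (ij : (i <= j)%N) : ordmap 1%N n :=
  OrdMap (edge_fun_le ij).

Definition tri_fun n (i j l : 'I_n.+1) (t : 'I_3) : 'I_n.+1 :=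
  match val t with 0%N => i | 1%N => j | _ => l end.

Lemma tri_fun_le n (i j l : 'I_n.+1) (ij : (i <= j)%N) (jl : (j <= l)%N)
  (s t : 'I_3) : (s <= t)%N -> (tri_fun i j l s <= tri_fun i j l t)%N.
Proof.
have il := leq_trans ij jl.
by move: s t => [[|[|[|s]]] hs] [[|[|[|t]]] ht].
Qed.

Definition om_tri n (i j l : 'I_n.+1) (ij : (i <= j)%N) (jl : (j <= l)%N) :
  ordmap 2%N n := OrdMap (tri_fun_le ij jl).

Lemma nX_irr (A' : cat_group) n (s : Bcg A' n) (i j : 'I_n.+1) (p q : (i <= j)%N) :
  nX s p = nX s q.
Proof. by rewrite (bool_irrelevance p q). Qed.

Lemma gsimplex_sop m n (a : ordmap m n) (v : 'I_n.+1 -> G) :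
  sop a (gsimplex v) = gsimplex (fun i => v (a i)).
Proof. exact: gnerve_eq. Qed.

Lemma gedgeE n (s : BG G n) (i j : 'I_n.+1) (ij : (i <= j)%N) :
  gedge (nX s ij) = sop (om_edge ij) s.
Proof.
apply: gnerve_eq => -[[|[|a]] ha] [[|[|b]] hb] //= ab;
  rewrite ?mulVg ?invg1 ?mul1g;
  by [exact: esym (gnerve_diag _ _) | exact: (@nX_irr (discrete G) n s)].
Qed.

Lemma gtriangleE n (s : BG G n) (i j l : 'I_n.+1) (ij : (i <= j)%N) (jl : (j <= l)%N) :
  gtriangle (nX s ij) (nX s jl) = sop (om_tri ij jl) s.
Proof.
apply: gnerve_eq => -[[|[|[|a]]] ha] [[|[|[|b]]] hb] //= ab;
  rewrite ?mulVg ?invg1 ?mul1g ?mulKg;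
  by [exact: gnerve_mul | exact: esym (gnerve_diag _ _) | exact: (@nX_irr (discrete G) n s)].
Qed.

Lemma map_obj n (s : BG G n) (i j : 'I_n.+1) (ij : (i <= j)%N) :
  nX (sm φ s) ij = map_ob (nX s ij).
Proof.
rewrite /map_ob gedgeE sm_nat /=; exact: nX_irr.
Qed.

Lemma map_obj_eq n (s : BG G n) (i j : 'I_n.+1) (ij : (i <= j)%N) (g : G) :
  nX s ij = g -> nX (sm φ s) ij = map_ob g.
Proof. by move=> <-; exact: map_obj. Qed.

Local Notation o0 := (@Ordinal 3 0 isT).
Local Notation o1 := (@Ordinal 3 1 isT).
Local Notation o2 := (@Ordinal 3 2 isT).

Lemma gtriangle01 g h : nX (gtriangle g h) (i := o0) (j := o1) isT = g.
Proof. by rewrite /= invg1 mul1g. Qed.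

Lemma gtriangle12 g h : nX (gtriangle g h) (i := o1) (j := o2) isT = h.
Proof. by rewrite /= mulKg. Qed.

Lemma gtriangle02 g h : nX (gtriangle g h) (i := o0) (j := o2) isT = g * h.
Proof. by rewrite /= invg1 mul1g. Qed.

Definition map_mul (g h : G) : hom (map_ob g ⊗ map_ob h) (map_ob (g * h)) :=
  idto (map_obj_eq (gtriangle02 g h))
  ∘ nT (sm φ (gtriangle g h)) (i := o0) (j := o1) (l := o2) isT isT isT
  ∘ (idto (esym (map_obj_eq (gtriangle01 g h)))
     ⊠ idto (esym (map_obj_eq (gtriangle12 g h)))).

Lemma nT_transport n (s s' : nerve_simplex A n) (e : s = s') (i j l : 'I_n.+1)
    (ij ij' : (i <= j)%N) (jl jl' : (j <= l)%N) (il il' : (i <= l)%N)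
    (e1 : nX s ij = nX s' ij') (e2 : nX s jl = nX s' jl')
    (e3 : nX s il = nX s' il') :
  idto e3 ∘ nT s ij jl il = nT s' ij' jl' il' ∘ (idto e1 ⊠ idto e2).
Proof.
subst s'; move: e1 e2 e3.
rewrite (bool_irrelevance ij' ij) (bool_irrelevance jl' jl) (bool_irrelevance il' il).
by move=> e1 e2 e3; rewrite !idto_id thom1 ccomp1f ccompf1.
Qed.

Lemma map_mulE n (s : BG G n) (i j l : 'I_n.+1)
    (ij : (i <= j)%N) (jl : (j <= l)%N) (il : (i <= l)%N) (g h : G)
    (e1 : nX (sm φ s) ij = map_ob g) (e2 : nX (sm φ s) jl = map_ob h)
    (e3 : nX (sm φ s) il = map_ob (g * h)) :
  nX s ij = g -> nX s jl = h ->
  idto e3 ∘ nT (sm φ s) ij jl il = map_mul g h ∘ (idto e1 ⊠ idto e2).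
Proof.
move=> eg eh; subst g h; pose a := om_tri ij jl.
pose t := sm φ (gtriangle (nX s ij) (nX s jl)).
have e : sop a (sm φ s) = t by rewrite /t gtriangleE sm_nat.
have S (b1 : nX (sm φ s) ij = nX t (i := o0) (j := o1) isT)
       (b2 : nX (sm φ s) jl = nX t (i := o1) (j := o2) isT)
       (b3 : nX (sm φ s) il = nX t (i := o0) (j := o2) isT) :
    idto b3 ∘ nT (sm φ s) ij jl il
    = nT t (i := o0) (j := o1) (l := o2) isT isT isT ∘ (idto b1 ⊠ idto b2).
  have h01 : (o0 <= o1)%N by []. have h12 : (o1 <= o2)%N by [].
  have h02 : (o0 <= o2)%N by [].
  pose P1 : (i <= j)%N := om_le a h01; pose P2 : (j <= l)%N := om_le a h12.
  pose P3 : (i <= l)%N := om_le a h02.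
  have S2 (c1 : nX (sm φ s) P1 = _) (c2 : nX (sm φ s) P2 = _)
      (c3 : nX (sm φ s) P3 = _) :
      idto c3 ∘ nT (sm φ s) P1 P2 P3
      = nT t (i := o0) (j := o1) (l := o2) isT isT isT ∘ (idto c1 ⊠ idto c2).
    exact: (nT_transport e (ij := h01) (jl := h12) (il := h02)).
  move: S2; rewrite (bool_irrelevance P1 ij) (bool_irrelevance P2 jl)
    (bool_irrelevance P3 il); exact.
have b3 := etrans e3 (esym (map_obj_eq (gtriangle02 (nX s ij) (nX s jl)))).
rewrite /map_mul -/t -!ccompA -thomM !idto_comp -(S _ _ b3).
by rewrite ccompA idto_comp; congr (_ ∘ _); apply: idto_irr.
Qed.

Lemma map_cocycle (g h l : G) :
  idto (f_equal map_ob (mulgA g h l)) ∘ map_mul g (h * l)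
    ∘ (cid (map_ob g) ⊠ map_mul h l) ∘ ass (map_ob g) (map_ob h) (map_ob l)
  = map_mul (g * h) l ∘ (map_mul g h ⊠ cid (map_ob l)).
Proof.
pose s := gtetra g h l.
pose i0 := @Ordinal 4 0 isT; pose i1 := @Ordinal 4 1 isT.
pose i2 := @Ordinal 4 2 isT; pose i3 := @Ordinal 4 3 isT.
have h01 : (i0 <= i1)%N by []. have h12 : (i1 <= i2)%N by [].
have h23 : (i2 <= i3)%N by []. have h02 : (i0 <= i2)%N by [].
have h13 : (i1 <= i3)%N by []. have h03 : (i0 <= i3)%N by [].
have X01 : nX s h01 = g by rewrite /= invg1 mul1g.
have X12 : nX s h12 = h by rewrite /= mulKg.
have X23 : nX s h23 = l by rewrite /= mulKg.
have X02 : nX s h02 = g * h by rewrite /= invg1 mul1g.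
have X13 : nX s h13 = h * l by rewrite /= -mulgA mulKg.
have X03 : nX s h03 = g * h * l by rewrite /= invg1 mul1g.
have X03' : nX s h03 = g * (h * l) by rewrite X03 mulgA.
have := n_assoc (sm φ s) h01 h12 h23 h02 h13 h03.
have T1 := map_mulE (map_obj_eq X01) (map_obj_eq X12) (map_obj_eq X02) X01 X12.
have T2 := map_mulE (map_obj_eq X02) (map_obj_eq X23) (map_obj_eq X03) X02 X23.
have T3 := map_mulE (map_obj_eq X12) (map_obj_eq X23) (map_obj_eq X13) X12 X23.
have T4 := map_mulE (map_obj_eq X01) (map_obj_eq X13) (map_obj_eq X03') X01 X13.
move=> E; move: T1 T2 T3 T4.
move: (map_mul g h) (map_mul (g * h) l) (map_mul h l) (map_mul g (h * l)).
move=> m1 m2 m3 m4 T1 T2 T3 T4; set p01 := map_obj_eq X01 in T1 T4 *; set p12 := map_obj_eq X12 in T1 T3 *.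
set p23 := map_obj_eq X23 in T2 T3 *; set p02 := map_obj_eq X02 in T1 T2 *.
set p13 := map_obj_eq X13 in T3 T4 *; set p03 := map_obj_eq X03 in T2 *.
set p03' := map_obj_eq X03' in T4 *.
have iI : is_iso ((idto p01 ⊠ idto p12) ⊠ idto p23) by apply: cg_groupoid.
apply: (iso_epi iI).
have -> : m2 ∘ (m1 ⊠ cid (map_ob l))
    ∘ ((idto p01 ⊠ idto p12) ⊠ idto p23)
    = idto p03 ∘ (nT (sm φ s) h02 h23 h03 ∘ (nT (sm φ s) h01 h12 h02 ⊠ cid _)).
  rewrite -ccompA -thomM -T1 ccomp1f ccompA T2 -ccompA -thomM ccompf1.
  by [].
rewrite E -ccompA idto_ass !ccompA -[in LHS](ccompA _ (_ ⊠ _) (_ ⊠ _)) -thomM.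
rewrite -T3 ccomp1f.
have -> : idto p01 ⊠ (idto p13 ∘ nT (sm φ s) h12 h23 h13)
    = (idto p01 ⊠ idto p13) ∘ (cid _ ⊠ nT (sm φ s) h12 h23 h13).
  by rewrite -thomM ccompf1.
rewrite !ccompA -[in LHS](ccompA _ m4) -T4 !ccompA idto_comp.
by congr (_ ∘ _ ∘ _ ∘ _); apply: idto_irr.
Qed.

Definition action_of_map : action G A := Action map_cocycle.

End Action_of_map.

(** [f] is well defined and bijective on equivalence classes. *)
Definition induces_bijection (X Y : Type) (R : relation X) (S : relation Y)
    (f : X -> Y) : Prop :=
  (forall x x', R x x' <-> S (f x) (f x')) /\ (forall y, exists x, S (f x) y).

(** Two matching pairs of equivalence relations: pointed homotopy corresponds to
    isomorphisms [F_g -> F'_g], free homotopy to isomorphisms which may move [C]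
    by an autoequivalence [P]. The last clause is naturality in [G]. *)
Definition actions_classified_by_maps (G : groupType) (A : cat_group) : Prop :=
  [/\ induces_bijection (@phomotopic (BG G) (Bcg A)) (@action_iso G A)
        (fun φ => action_of_map φ),
      induces_bijection (@homotopic (BG G) (Bcg A)) (@action_conj G A)
        (fun φ => action_of_map φ)
    & forall (H : groupType) (f : {multiplicative H -> G})
        (φ : smap (BG G) (Bcg A)),
        action_iso (action_of_map (smap_comp φ (Bhom f)))
          (action_pull f (action_of_map φ))].

(* Main.v *)
(** Maps into the nerve of a categorical group [A] from a nerve [N K] are lax
    functors [K -> A]; for [K = G] these are actions of [G], the unit constraints
    being determined by the multiplication because tensoring with an object is
    fully faithful. For [K = G × [1]] they are two actions together with a bimodule
    [D : G -> A] over them. Restricting the two legs of the prism over [g] to the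
    identity of [1] shows that [D_g] is both [F_g ⊗ D_1] and [D_1 ⊗ F'_g], so a
    homotopy is a conjugation by [P = D_1], and conversely [D_g = P ⊗ F_g] turns a
    conjugation into a homotopy. A pointed homotopy forces [D_1] to be the unit
    object, and then the conjugation is an isomorphism of actions. Since
    associators of autoequivalences have identity components, the calculations
    with conjugations are carried out componentwise. *)

Require Import Defs.
From mathcomp Require Import all_boot all_order all_algebra.
From Stdlib Require Import FunctionalExtensionality ProofIrrelevance IndefiniteDescription.
From Stdlib Require Import Relations.
Import Defs.

Set Implicit Arguments.
Unset Strict Implicit.
Unset Printing Implicit Defensive.

Local Open Scope group_scope.
Local Open Scope cat_scope.

Lemma rwl_thom (M : moncat) (a b c a' b' c' d : M) (g : hom b c) (f : hom a b)
    (g' : hom b' c') (f' : hom a' b') (k : hom (c ⊗ c') d) :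
  k ∘ (g ⊠ g') ∘ (f ⊠ f') = k ∘ ((g ∘ f) ⊠ (g' ∘ f')).
Proof. by rewrite thomM ccompA. Qed.

(** * Tensoring with an object is fully faithful *)

Section Tensoring.
Variable A : cat_group.
Implicit Types x y z P : A.

Lemma cg_epi x y z (f : hom x y) (g h : hom y z) : g ∘ f = h ∘ f -> g = h.
Proof. exact: iso_epi (cg_groupoid f). Qed.

Lemma cg_mono x y z (f : hom y z) (g h : hom x y) : f ∘ g = f ∘ h -> g = h.
Proof. exact: iso_mono (cg_groupoid f). Qed.

Lemma cg_inv x y (f : hom x y) : { g : hom y x | is_inverse f g }.
Proof. exact: iso_invE (cg_groupoid f). Qed.

Lemma cg_divl x y z (f : hom y z) (g : hom x z) : { h | f ∘ h = g }.
Proof.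
by have [i [_ fi]] := cg_inv f; exists (i ∘ g); rewrite ccompA fi ccomp1f.
Qed.

(** With [Q] an inverse of [P], the maps [N] undo tensoring with [P], naturally in [x]; this
    naturality is all that cancelling [P] requires. *)
Lemma tensl_retract P : exists (Q : A) (N : forall x, hom (Q ⊗ P ⊗ x) x),
  forall x y (f : hom x y), N y ∘ (cid Q ⊠ cid P ⊠ f) = f ∘ N x.
Proof.
have [Q [_ [e _]]] := cg_invertible P.
pose ai x := sval (cg_inv (ass Q P x)).
have aiK x : is_inverse (ass Q P x) (ai x) by exact: (svalP (cg_inv _)).
exists Q, (fun x => lun x ∘ (e ⊠ cid x) ∘ ai x) => x y f.
apply: (cg_epi (f := ass Q P x)).
rewrite -!ccompA -ass_nat (ccompA (ai y)) (aiK y).1 (aiK x).1 ccomp1f ccompf1.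
by rewrite thom1 -thomM ccomp1f ccompf1 ccompA -lun_nat -ccompA -thomM ccomp1f ccompf1.
Qed.

Lemma tensr_retract P : exists (Q : A) (N : forall x, hom ((x ⊗ P) ⊗ Q) x),
  forall x y (f : hom x y), N y ∘ ((f ⊠ cid P) ⊠ cid Q) = f ∘ N x.
Proof.
have [Q [[e _] _]] := cg_invertible P.
exists Q, (fun x => run x ∘ (cid x ⊠ e) ∘ ass x P Q) => x y f.
rewrite -(ccompA _ (ass _ _ _)) ass_nat thom1 !ccompA -(ccompA _ (cid y ⊠ e)).
by rewrite -thomM ccomp1f ccompf1 -run_nat -(ccompA _ (f ⊠ cid tunit)) -thomM ccomp1f ccompf1.
Qed.

Lemma tensl_faithful P x y (f g : hom x y) : cid P ⊠ f = cid P ⊠ g -> f = g.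
Proof.
have [Q [N NE]] := tensl_retract P => e.
by apply: (cg_epi (f := N x)); rewrite -!NE e.
Qed.

Lemma tensr_faithful P x y (f g : hom x y) : f ⊠ cid P = g ⊠ cid P -> f = g.
Proof.
have [Q [N NE]] := tensr_retract P => e.
by apply: (cg_epi (f := N x)); rewrite -!NE e.
Qed.

Lemma tensl_full P x y (h : hom (P ⊗ x) (P ⊗ y)) : exists f, cid P ⊠ f = h.
Proof.
have [Q [N NE]] := tensl_retract P.
have [i [iN Ni]] := cg_inv (N x).
(* The only candidate for [f], since [N] is natural; that [cid P ⊠ f] is [h] can be tested after
   tensoring with [Q]. *)
exists (N y ∘ (cid Q ⊠ h) ∘ i); apply: (tensl_faithful (P := Q)).
by apply: (cg_mono (f := N y)); rewrite NE -ccompA iN ccompf1.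
Qed.

End Tensoring.

(** * Conjugation by a fixed object, and lax functors with arrows labelled by [G] *)

Definition conj_by (G : groupType) (A : cat_group) (P : A) (a b : action G A) : Prop :=
  exists β : forall g, hom (P ⊗ aF a g) (aF b g ⊗ P),
    forall g h, forall ai, is_inverse (ass (aF b g) (aF b h) P) ai ->
      β (g * h) ∘ (cid P ⊠ aη a g h) ∘ ass P (aF a g) (aF a h)
      = (aη b g h ⊠ cid P) ∘ ai ∘ (cid (aF b g) ⊠ β h)
        ∘ ass (aF b g) P (aF a h) ∘ (β g ⊠ cid (aF a h)).

(** A lax functor to [A] from the category with objects [S] whose arrows
    [i -> j] are the elements of [G] if [r i j], and none otherwise. *)
Record lax (G : groupType) (A : cat_group) (S : Type) (r : rel S) := Lax {
  lX : forall i j, r i j -> G -> A;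
  lT : forall i j l (ij : r i j) (jl : r j l) (il : r i l) (g h gh : G),
    g * h = gh -> hom (lX ij g ⊗ lX jl h) (lX il gh);
  lA : forall i j l m (ij : r i j) (jl : r j l) (lm : r l m)
    (il : r i l) (jm : r j m) (im : r i m) (g h k gh hk ghk : G)
    (e1 : g * h = gh) (e2 : gh * k = ghk) (e3 : h * k = hk) (e4 : g * hk = ghk),
    lT il lm im e2 ∘ (lT ij jl il e1 ⊠ cid (lX lm k))
    = lT ij jm im e4 ∘ (cid (lX ij g) ⊠ lT jl lm jm e3)
      ∘ ass (lX ij g) (lX jl h) (lX lm k) }.

Section Lax.
Variables (G : groupType) (A : cat_group) (S : Type) (r : rel S).
Variable L : lax G A r.

(** Since [lT] does not depend on the proofs that it takes, equal labels give multiplications equal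
    up to casts. Naturality of the simplices of a lax functor reduces to this. *)
Lemma lT_cast i j l (ij ij' : r i j) (jl jl' : r j l) (il il' : r i l)
    (g h k g' h' k' : G) (e : g * h = k) (e' : g' * h' = k')
    (cg : lX L ij g = lX L ij' g') (ch : lX L jl h = lX L jl' h')
    (ck : lX L il k = lX L il' k') :
  g = g' -> h = h' ->
  idto ck ∘ lT L ij jl il e = lT L ij' jl' il' e' ∘ (idto cg ⊠ idto ch).
Proof.
move=> eg eh; subst g' h'; have ek : k' = k by rewrite -e -e'.
move: e' cg ch ck; rewrite {}ek.
rewrite (bool_irrelevance ij' ij) (bool_irrelevance jl' jl) (bool_irrelevance il' il).
move=> e' cg ch ck.
by rewrite !idto_id thom1 ccomp1f ccompf1 (proof_irrelevance _ e e').
Qed.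

(* Associativity makes [T(o,o) ∘ (1 ⊗ u) = r] a sufficient condition for [u] to be
   a two-sided unit everywhere, and such a [u] exists because tensoring with an
   object is fully faithful. *)
Lemma lax_unit i (ii : r i i) (o : G) : o = 1 ->
  exists u : hom tunit (lX L ii o),
    (forall j (ij : r i j) g (e : o * g = g),
       lT L ii ij ij e ∘ (u ⊠ cid (lX L ij g)) = lun (lX L ij g)) /\
    (forall j (ji : r j i) g (e : g * o = g),
       lT L ji ii ji e ∘ (cid (lX L ji g) ⊠ u) = run (lX L ji g)).
Proof.
move=> o1; have oo : o * o = o by rewrite o1 mulg1.
have [v vE] := cg_divl (lT L ii ii ii oo) (run (lX L ii o)).
have [u uv] := tensl_full v; subst v; exists u.
have left j (ij : r i j) g (e : o * g = g) :
    lT L ii ij ij e ∘ (u ⊠ cid (lX L ij g)) = lun (lX L ij g).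
  apply: (@tensl_faithful _ (lX L ii o)).
  apply: (cg_mono (f := lT L ii ij ij e)); apply: (cg_epi (f := ass _ _ _)).
  have := lA L ii ii ij ii ij ij oo e e e => /(f_equal (fun t => t ∘ ((cid _ ⊠ u) ⊠ cid _))).
  rewrite -!ccompA ass_nat -thomM vE ccomp1f (ccompA (cid _ ⊠ _)) -thomM ccomp1f => <-.
  by rewrite triangle.
split=> // j ji g e.
apply: (@tensr_faithful _ (lX L ii o)); apply: (cg_mono (f := lT L ji ii ji e)).
have := lA L ji ii ii ji ii ji e e oo e => /(f_equal (fun t => t ∘ ((cid _ ⊠ u) ⊠ cid _))).
rewrite -!ccompA ass_nat -thomM ccomp1f (ccompA (cid _ ⊠ _)) -thomM ccomp1f => ->.
by rewrite left triangle.
Qed.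

(** The restriction of the lax functor to the endomorphisms of [i]. *)
Program Definition diag i (ii : r i i) : action G A :=
  @Action G A (lX L ii) (fun g h => lT L ii ii ii (erefl (g * h))) _.
Next Obligation.
have := @lT_cast i i i ii ii ii ii ii ii g (h * l) _ g (h * l) _
  erefl (mulgA g h l) erefl erefl (f_equal (lX L ii) (mulgA g h l)) erefl erefl.
rewrite thom1 ccompf1 => ->.
by rewrite (lA L ii ii ii ii ii ii erefl erefl erefl (mulgA g h l)).
Qed.

(** Both the [ii] object tensored with [P] and [P] tensored with the [jj] object map isomorphically
    to [lX L ij g], and [β g] compares them. Its compatibility comes from [lA] for the three
    positions of the arrow from [i] to [j] in a composable triple. *)
Lemma lax_conj i j (ii : r i i) (jj : r j j) (ij : r i j) :
  conj_by (lX L ij 1) (diag jj) (diag ii).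
Proof.
pose P := lX L ij 1.
pose α g : hom (lX L ii g ⊗ P) (lX L ij g) := lT L ii ij ij (mulg1 g).
pose α' g : hom (P ⊗ lX L jj g) (lX L ij g) := lT L ij jj ij (mul1g g).
pose β g := sval (cg_divl (α g) (α' g)).
have βE g : α g ∘ β g = α' g := svalP (cg_divl (α g) (α' g)).
exists β => g h /= ai [_ aiK]; apply: (cg_mono (f := α (g * h))).
rewrite !ccompA βE /α' -(lA L ij jj jj ij jj ij (mul1g g) erefl erefl (mul1g (g * h))).
rewrite /α (lA L ii ii ij ii ij ij erefl (mulg1 (g * h)) (mulg1 h) erefl).
rewrite (rwl aiK) ccompf1 rwl_thom ccomp1f βE.
rewrite /α' -(lA L ii ij jj ij ij ij (mulg1 g) erefl (mul1g h) erefl).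
by rewrite rwl_thom βE ccomp1f.
Qed.

End Lax.

(** * Simplicial maps and homotopies defined by lax functors *)

Section Nerve_maps.
Variables (G : groupType) (A : cat_group).

(** The multiplications determine the unit constraints, through [n_unitl] and faithfulness of
    tensoring, so edges and triangles determine a simplex. *)
Lemma nerve_eq n (s t : Bcg A n)
    (e : forall (i j : 'I_n.+1) (ij : (i <= j)%N), nX s ij = nX t ij) :
  (forall (i j l : 'I_n.+1) (ij : (i <= j)%N) (jl : (j <= l)%N) (il : (i <= l)%N),
     idto (e _ _ il) ∘ nT s ij jl il = nT t ij jl il ∘ (idto (e _ _ ij) ⊠ idto (e _ _ jl))) ->
  s = t.
Proof.
case: s e => X T U a1 a2 a3; case: t => X' T' U' b1 b2 b3 /= e eT.
have eX : X = X'.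
  apply: functional_extensionality_dep => i; apply: functional_extensionality_dep => j.
  exact: functional_extensionality_dep.
subst X'.
have {}eT : T = T'.
  do 3! apply: functional_extensionality_dep => ?.
  apply: functional_extensionality_dep => ij; apply: functional_extensionality_dep => jl.
  apply: functional_extensionality_dep => il; move: (eT _ _ _ ij jl il).
  by rewrite !idto_id thom1 ccomp1f ccompf1.
subst T'.
have eU : U = U'.
  apply: functional_extensionality_dep => i; apply: functional_extensionality_dep => ii.
  apply: (@tensr_faithful _ (X i i ii)); apply: (cg_mono (f := T _ _ _ ii ii ii)).
  by rewrite a2 b2.
by subst U'; f_equal; apply: proof_irrelevance.
Qed.

Section Realization.
Variables (S : Type) (r : rel S) (L : lax G A r).
Variables (n : nat) (s : BG G n) (c : 'I_n.+1 -> S).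
Hypothesis cr : forall i j : 'I_n.+1, (i <= j)%N -> r (c i) (c j).

(** The colours [c] and the labels of [s] form a chain of arrows in the source of [L]. Unit
    constraints are picked by choice from [lax_unit]; [nerve_eq] makes the result natural whatever
    the choice. *)
Program Definition lax_simplex : Bcg A n :=
  @NerveSimplex A n (fun i j ij => lX L (cr ij) (nX s ij))
    (fun i j l ij jl il => lT L (cr ij) (cr jl) (cr il) (gnerve_mul s ij jl il))
    (fun i ii => sval (constructive_indefinite_description _
                         (lax_unit L (cr ii) (gnerve_diag s ii)))) _ _ _.
Next Obligation. exact: lA. Qed.
Next Obligation.
by case: constructive_indefinite_description => u [/= uL _]; apply: uL.
Qed.
Next Obligation.
by case: constructive_indefinite_description => u [/= _ uR]; apply: uR.
Qed.

End Realization.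

Program Definition lax_map (L : lax G A (fun _ _ : unit => true)) :
    smap (BG G) (Bcg A) :=
  @SMap (BG G) (Bcg A) (fun n s => @lax_simplex _ _ L n s (fun=> tt) (fun _ _ _ => isT)) _.
Next Obligation.
unshelve refine (nerve_eq _); first by [].
by move=> i j l ij jl il; exact: lT_cast.
Qed.

(** A simplex of the interval becomes a colouring of vertices by [bool], on which [implb] is the
    order. *)
Definition colour n (t : ordmap n 1) (i : 'I_n.+1) : bool := (0 < t i)%N.

Lemma colour_le n (t : ordmap n 1) (i j : 'I_n.+1) : (i <= j)%N ->
  colour t i ==> colour t j.
Proof. by move=> ij; apply/implyP => /leq_trans; apply; exact: om_le. Qed.

Program Definition lax_homotopy (L : lax G A implb) :
    smap (sprod (BG G) (std_simplex 1)) (Bcg A) :=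
  @SMap (sprod (BG G) (std_simplex 1)) (Bcg A)
    (fun n x => @lax_simplex _ _ L n x.1 (colour x.2) (@colour_le n x.2)) _.
Next Obligation.
unshelve refine (nerve_eq _).
  by move=> i j ij /=; congr (lX L _ _); exact: bool_irrelevance.
by move=> i j l ij jl il; exact: lT_cast.
Qed.

End Nerve_maps.

(** * Isomorphisms of actions, and actions as lax functors *)

Section Action_iso.
Variables (G : groupType) (A : cat_group).
Implicit Types a b c : action G A.

Lemma action_iso_refl a : action_iso a a.
Proof. by exists (fun g => cid _) => g h; rewrite thom1 ccomp1f ccompf1. Qed.

Lemma action_iso_sym a b : action_iso a b -> action_iso b a.
Proof.
move=> [α αE]; pose α' g := sval (cg_inv (α g)).
have αK g : is_inverse (α g) (α' g) := svalP (cg_inv (α g)).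
exists α' => g h; apply: (cg_mono (f := α (g * h))).
rewrite !ccompA (αK _).2 ccomp1f αE rwl_thom !(αK _).2 thom1 ccompf1 //.
Qed.

Lemma action_iso_trans a b c : action_iso a b -> action_iso b c -> action_iso a c.
Proof.
move=> [α αE] [β βE]; exists (fun g => β g ∘ α g) => g h.
by rewrite -ccompA αE ccompA βE thomM ccompA.
Qed.

(* Locked, because unification would otherwise see through it to a composite. *)
Definition graded_η a (g h k : G) (e : g * h = k) : hom (aF a g ⊗ aF a h) (aF a k) :=
  locked (idto (f_equal (aF a) e) ∘ aη a g h).

Lemma graded_ηE a (g h k : G) (e : g * h = k) :
  graded_η a e = idto (f_equal (aF a) e) ∘ aη a g h.
Proof. by rewrite /graded_η -lock. Qed.

Lemma graded_η1 a (g h : G) : graded_η a (erefl (g * h)) = aη a g h.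
Proof. by rewrite graded_ηE; exact: ccomp1f. Qed.

(** The casts are absorbed by the equations between labels, which gives the cocycle condition the
    shape of the axiom [lA]. *)
Lemma graded_ηA a (g h k gh hk ghk : G) (e1 : g * h = gh) (e2 : gh * k = ghk)
    (e3 : h * k = hk) (e4 : g * hk = ghk) :
  graded_η a e2 ∘ (graded_η a e1 ⊠ cid (aF a k))
  = graded_η a e4 ∘ (cid (aF a g) ⊠ graded_η a e3) ∘ ass (aF a g) (aF a h) (aF a k).
Proof.
subst gh hk; move: e4; case: ghk / e2 => e4.
rewrite !graded_η1 -a_cocycle graded_ηE.
by rewrite (proof_irrelevance _ e4 (mulgA g h k)).
Qed.

Definition action_lax a : lax G A (fun _ _ : unit => true) :=
  @Lax G A unit (fun _ _ => true) (fun _ _ _ => aF a)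
    (fun _ _ _ _ _ _ => @graded_η a)
    (fun _ _ _ _ _ _ _ _ _ _ => @graded_ηA a).

(** The edge of [gedge g] is [1^-1 * g], which equals [g] but not by computation; hence an
    isomorphism made of casts. *)
Lemma lax_map_action (L : lax G A (fun _ _ : unit => true)) :
  action_iso (action_of_map (lax_map L)) (@diag _ _ _ _ L tt isT).
Proof.
have E (g : G) : nX (gedge g) i01 = g by rewrite /= invg1 mul1g.
exists (fun g => idto (f_equal (lX L (i := tt) (j := tt) isT) (E g))) => g h /=.
have M := map_mulE (map_obj_eq (lax_map L) (gtriangle01 g h))
  (map_obj_eq (lax_map L) (gtriangle12 g h)) (map_obj_eq (lax_map L) (gtriangle02 g h))
  (gtriangle01 g h) (gtriangle12 g h).
apply: (cg_epi (f := idto (map_obj_eq (lax_map L) (gtriangle01 g h))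
  ⊠ idto (map_obj_eq (lax_map L) (gtriangle12 g h)))).
rewrite -[LHS]ccompA -[X in _ ∘ X = _]M -[RHS]ccompA -thomM !idto_comp ccompA idto_comp.
by apply: lT_cast; [exact: gtriangle01 | exact: gtriangle12].
Qed.

End Action_iso.

(** * The lax functor on [G] times the interval given by a homotopy *)

Section Homotopy_lax.
Variables (G : groupType) (A : cat_group).
Variable h : smap (sprod (BG G) (std_simplex 1)) (Bcg A).
Local Notation I := 'I_2.

(** The value of [h] on the edge of the prism labelled [g] over [i <= j]: an object of one of the
    two actions if [i = j], the bimodule object [D_g] if [i < j]. *)
Definition hom_ob (i j : I) (ij : (i <= j)%N) (g : G) : A :=
  nX (sm h (gedge g, om_edge ij)) i01.

Lemma sm_sop m n (a : ordmap m n) (s : BG G n) (t : ordmap n 1) :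
  sm h (sop a s, om_comp t a) = sop a (sm h (s, t)).
Proof. exact: (sm_nat h a (s, t)). Qed.

Lemma hom_obE n (s : BG G n) (t : ordmap n 1) (i j : 'I_n.+1) (ij : (i <= j)%N) :
  nX (sm h (s, t)) ij = hom_ob (om_le t ij) (nX s ij).
Proof.
rewrite /hom_ob gedgeE.
have -> : om_edge (om_le t ij) = om_comp t (om_edge ij).
  by apply: om_eq => -[[|[|]]].
rewrite sm_sop /=; exact: nX_irr.
Qed.

Local Notation o0 := (@Ordinal 3 0 isT).
Local Notation o1 := (@Ordinal 3 1 isT).
Local Notation o2 := (@Ordinal 3 2 isT).

Lemma hom_ob_eq n (s : BG G n) (t : ordmap n 1) (i j : 'I_n.+1) (ij : (i <= j)%N)
    (i' j' : I) (ij' : (i' <= j')%N) g :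
  t i = i' -> t j = j' -> nX s ij = g -> nX (sm h (s, t)) ij = hom_ob ij' g.
Proof.
by move=> ti tj <-; subst i' j'; rewrite hom_obE; congr (hom_ob _ _); exact: bool_irrelevance.
Qed.

Definition hom_mul (i j l : I) (ij : (i <= j)%N) (jl : (j <= l)%N) (il : (i <= l)%N)
    (g g' k : G) (e : g * g' = k) : hom (hom_ob ij g ⊗ hom_ob jl g') (hom_ob il k) :=
  let x := (gtriangle g g', om_tri ij jl) in
  idto (@hom_ob_eq _ x.1 x.2 o0 o2 isT i l il k erefl erefl (etrans (gtriangle02 g g') e))
  ∘ nT (sm h x) (i := o0) (j := o1) (l := o2) isT isT isT
  ∘ (idto (esym (@hom_ob_eq _ x.1 x.2 o0 o1 isT i j ij g erefl erefl (gtriangle01 g g')))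
     ⊠ idto (esym (@hom_ob_eq _ x.1 x.2 o1 o2 isT j l jl g' erefl erefl (gtriangle12 g g')))).

(** Pulling back along [om_tri ij jl] gives a standard triangle of the prism, and naturality of [h]
    transfers the multiplication. *)
Lemma hom_mulE n (s : BG G n) (t : ordmap n 1) (i j l : 'I_n.+1)
    (ij : (i <= j)%N) (jl : (j <= l)%N) (il : (i <= l)%N) (i' j' l' : I)
    (ij' : (i' <= j')%N) (jl' : (j' <= l')%N) (il' : (i' <= l')%N)
    (g g' k : G) (e : g * g' = k)
    (e1 : nX (sm h (s, t)) ij = hom_ob ij' g)
    (e2 : nX (sm h (s, t)) jl = hom_ob jl' g')
    (e3 : nX (sm h (s, t)) il = hom_ob il' k) :
  t i = i' -> t j = j' -> t l = l' -> nX s ij = g -> nX s jl = g' ->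
  idto e3 ∘ nT (sm h (s, t)) ij jl il = hom_mul ij' jl' il' e ∘ (idto e1 ⊠ idto e2).
Proof.
move=> ti tj tl eg eg'; subst g g' i' j' l'.
pose a := om_tri ij jl.
pose h01 : (o0 <= o1)%N := isT. pose h12 : (o1 <= o2)%N := isT.
pose h02 : (o0 <= o2)%N := isT.
set x := (gtriangle (nX s ij) (nX s jl), om_tri ij' jl').
have ex : sop a (sm h (s, t)) = sm h x.
  rewrite -sm_sop /x gtriangleE; congr (sm h (_, _)).
  by apply: om_eq => -[[|[|[|]]]].
have [E1 [E2 E3]] : nX (sm h (s, t)) ij = nX (sm h x) h01
    /\ nX (sm h (s, t)) jl = nX (sm h x) h12
    /\ nX (sm h (s, t)) il = nX (sm h x) h02.
  by rewrite -ex; split; [|split]; exact: nX_irr.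
have := @nT_transport A 2 _ _ ex o0 o1 o2 h01 h01 h12 h12 h02 h02.
rewrite /= (bool_irrelevance (tri_fun_le _ _ h01) ij) (bool_irrelevance (tri_fun_le _ _ h12) jl)
  (bool_irrelevance (tri_fun_le _ _ h02) il) => /(_ E1 E2 E3) T.
rewrite /hom_mul -/x -!ccompA -thomM !idto_comp.
rewrite [X in _ ⊠ X](idto_irr _ E2) [X in X ⊠ _](idto_irr _ E1) -[X in _ = _ ∘ X]T ccompA.
by rewrite idto_comp; congr (_ ∘ _); exact: idto_irr.
Qed.

Definition tetra_fun (i j l m : I) (t : 'I_4) : I :=
  match val t with 0%N => i | 1%N => j | 2%N => l | _ => m end.

Lemma tetra_fun_le (i j l m : I) (ij : (i <= j)%N) (jl : (j <= l)%N) (lm : (l <= m)%N)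
  (s t : 'I_4) : (s <= t)%N -> (tetra_fun i j l m s <= tetra_fun i j l m t)%N.
Proof.
have il := leq_trans ij jl; have jm := leq_trans jl lm; have im := leq_trans ij jm.
by move: s t => [[|[|[|[|s]]]] hs] [[|[|[|[|t]]]] ht].
Qed.

Definition om_tetra (i j l m : I) (ij : (i <= j)%N) (jl : (j <= l)%N) (lm : (l <= m)%N) :
  ordmap 3 1 := OrdMap (tetra_fun_le ij jl lm).

(** This is [n_assoc] for the image of the tetrahedron with successive edges [g], [g'], [k] and
    vertices over [i], [j], [l], [m], its four faces being read by [hom_mulE]. *)
Lemma hom_mulA (i j l m : I) (ij : (i <= j)%N) (jl : (j <= l)%N) (lm : (l <= m)%N)
    (il : (i <= l)%N) (jm : (j <= m)%N) (im : (i <= m)%N) (g g' k gh hk ghk : G)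
    (e1 : g * g' = gh) (e2 : gh * k = ghk) (e3 : g' * k = hk) (e4 : g * hk = ghk) :
  hom_mul il lm im e2 ∘ (hom_mul ij jl il e1 ⊠ cid (hom_ob lm k))
  = hom_mul ij jm im e4 ∘ (cid (hom_ob ij g) ⊠ hom_mul jl lm jm e3)
    ∘ ass (hom_ob ij g) (hom_ob jl g') (hom_ob lm k).
Proof.
pose s := gtetra g g' k; pose t := om_tetra ij jl lm.
pose i0 := @Ordinal 4 0 isT; pose i1 := @Ordinal 4 1 isT.
pose i2 := @Ordinal 4 2 isT; pose i3 := @Ordinal 4 3 isT.
have h01 : (i0 <= i1)%N by []. have h12 : (i1 <= i2)%N by [].
have h23 : (i2 <= i3)%N by []. have h02 : (i0 <= i2)%N by [].
have h13 : (i1 <= i3)%N by []. have h03 : (i0 <= i3)%N by [].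
have X01 : nX s h01 = g by rewrite /= invg1 mul1g.
have X12 : nX s h12 = g' by rewrite /= mulKg.
have X23 : nX s h23 = k by rewrite /= mulKg.
have X02 : nX s h02 = gh by rewrite /= invg1 mul1g.
have X13 : nX s h13 = hk by rewrite /= -mulgA mulKg.
have X03 : nX s h03 = ghk by rewrite /= invg1 mul1g e1.
have p01 : nX (sm h (s, t)) h01 = hom_ob ij g by exact: hom_ob_eq.
have p12 : nX (sm h (s, t)) h12 = hom_ob jl g' by exact: hom_ob_eq.
have p23 : nX (sm h (s, t)) h23 = hom_ob lm k by exact: hom_ob_eq.
have p02 : nX (sm h (s, t)) h02 = hom_ob il gh by exact: hom_ob_eq.
have p13 : nX (sm h (s, t)) h13 = hom_ob jm hk by exact: hom_ob_eq.
have p03 : nX (sm h (s, t)) h03 = hom_ob im ghk by exact: hom_ob_eq.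
have T1 := hom_mulE e1 p01 p12 p02 erefl erefl erefl X01 X12.
have T2 := hom_mulE e2 p02 p23 p03 erefl erefl erefl X02 X23.
have T3 := hom_mulE e3 p12 p23 p13 erefl erefl erefl X12 X23.
have T4 := hom_mulE e4 p01 p13 p03 erefl erefl erefl X01 X13.
apply: (cg_epi (f := (idto p01 ⊠ idto p12) ⊠ idto p23)).
rewrite rwl_thom ccomp1f -T1 -[idto p23]ccompf1 thomM ccompA -T2.
rewrite -[LHS]ccompA (n_assoc (sm h (s, t)) h01 h12 h23 h02 h13 h03).
rewrite ccompf1 -[RHS]ccompA idto_ass !ccompA rwl_thom ccomp1f -T3.
have -> : idto p01 ⊠ (idto p13 ∘ nT (sm h (s, t)) h12 h23 h13)
    = (idto p01 ⊠ idto p13) ∘ (cid _ ⊠ nT (sm h (s, t)) h12 h23 h13).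
  by rewrite -thomM ccompf1.
by rewrite !ccompA -T4.
Qed.

Definition hom_lax : lax G A (fun i j : I => (i <= j)%N) := Lax hom_mulA.

(** At this end [h] and [φ] agree on simplices, so casts suffice. One triangle is read by [T]
    through [h] and by [M] through [φ], and [N] compares the two. *)
Lemma hom_lax_end (φ : smap (BG G) (Bcg A)) (i : I) (ii : (i <= i)%N) :
  (forall n (s : BG G n), sm h (s, om_const n i) = sm φ s) ->
  action_iso (diag hom_lax ii) (action_of_map φ).
Proof.
move=> hφ.
have E g : hom_ob ii g = map_ob φ g.
  by rewrite /map_ob -hφ; apply: esym; apply: hom_ob_eq; rewrite //= invg1 mul1g.
exists (fun g => idto (E g)) => g g' /=.
pose s := gtriangle g g'; pose t : ordmap 2 1 := om_const 2 i.
have e1 : nX (sm h (s, t)) (i := o0) (j := o1) isT = hom_ob ii g.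
  by apply: hom_ob_eq => //; exact: gtriangle01.
have e2 : nX (sm h (s, t)) (i := o1) (j := o2) isT = hom_ob ii g'.
  by apply: hom_ob_eq => //; exact: gtriangle12.
have e3 : nX (sm h (s, t)) (i := o0) (j := o2) isT = hom_ob ii (g * g').
  by apply: hom_ob_eq => //; exact: gtriangle02.
have T := hom_mulE (erefl (g * g')) e1 e2 e3 erefl erefl erefl
  (gtriangle01 g g') (gtriangle12 g g').
have M := map_mulE (map_obj_eq φ (gtriangle01 g g')) (map_obj_eq φ (gtriangle12 g g'))
  (map_obj_eq φ (gtriangle02 g g')) (gtriangle01 g g') (gtriangle12 g g').
have c (i' j' : 'I_3) (ij' : (i' <= j')%N) : nX (sm h (s, t)) ij' = nX (sm φ s) ij'.
  by rewrite hφ.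
have N := nT_transport (hφ 2%N s) (c o0 o1 isT) (c o1 o2 isT) (c o0 o2 isT).
apply: (cg_epi (f := idto e1 ⊠ idto e2)).
rewrite -[LHS]ccompA -[X in _ ∘ X = _]T -[RHS]ccompA -thomM ccompA !idto_comp.
rewrite (idto_irr _ (etrans (c o0 o1 isT) (map_obj_eq φ (gtriangle01 g g')))).
rewrite (idto_irr (etrans e2 _) (etrans (c o1 o2 isT) (map_obj_eq φ (gtriangle12 g g')))).
rewrite -!idto_comp thomM ccompA -[X in _ = X ∘ _]M -[RHS]ccompA -[X in _ = _ ∘ X]N ccompA.
by rewrite !idto_comp; congr (_ ∘ _); exact: idto_irr.
Qed.

End Homotopy_lax.

(** * The homotopy defined by a bimodule over two actions *)

Section Homotopy_of_bimodule.
Variables (G : groupType) (A : cat_group).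

Lemma map_ηE (φ : smap (BG G) (Bcg A)) n (s : BG G n) (i j l : 'I_n.+1)
    (ij : (i <= j)%N) (jl : (j <= l)%N) (il : (i <= l)%N) :
  idto (map_obj φ s il) ∘ nT (sm φ s) ij jl il
  = graded_η (action_of_map φ) (gnerve_mul s ij jl il)
    ∘ (idto (map_obj φ s ij) ⊠ idto (map_obj φ s jl)).
Proof.
have E : nX (sm φ s) il = map_ob φ (nX s ij * nX s jl).
  by rewrite map_obj (gnerve_mul s ij jl il).
rewrite graded_ηE -[RHS]ccompA -[X in _ = _ ∘ X](map_mulE _ _ E erefl erefl) ccompA.
by rewrite idto_comp; congr (_ ∘ _); exact: idto_irr.
Qed.

(** A map is recovered from its action: [map_obj] and [map_ηE] give the edges and triangles of
    [sm φ s], and these determine the simplex. *)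
Lemma map_simplex (φ : smap (BG G) (Bcg A)) n (s : BG G n) (t : Bcg A n)
    (e : forall (i j : 'I_n.+1) (ij : (i <= j)%N), nX t ij = map_ob φ (nX s ij)) :
  (forall (i j l : 'I_n.+1) (ij : (i <= j)%N) (jl : (j <= l)%N) (il : (i <= l)%N),
     idto (e _ _ il) ∘ nT t ij jl il
     = graded_η (action_of_map φ) (gnerve_mul s ij jl il)
       ∘ (idto (e _ _ ij) ⊠ idto (e _ _ jl))) ->
  t = sm φ s.
Proof.
move=> eT; unshelve refine (nerve_eq _).
  by move=> i j ij; rewrite e map_obj.
move=> i j l ij jl il; set c3 := (X in idto X ∘ _).
apply: (cg_mono (f := idto (map_obj φ s il))).
rewrite !ccompA map_ηE idto_comp rwl_thom !idto_comp (idto_irr _ (e _ _ il)) eT.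
by congr (_ ∘ (_ ⊠ _)); exact: idto_irr.
Qed.

Variables (a b : action G A) (D : G -> A).
Variable l : forall g h k : G, g * h = k -> hom (aF a g ⊗ D h) (D k).
Variable r : forall g h k : G, g * h = k -> hom (D g ⊗ aF b h) (D k).

Hypothesis lA : forall (g h k gh hk ghk : G)
  (e1 : g * h = gh) (e2 : gh * k = ghk) (e3 : h * k = hk) (e4 : g * hk = ghk),
  l e2 ∘ (graded_η a e1 ⊠ cid (D k)) = l e4 ∘ (cid (aF a g) ⊠ l e3) ∘ ass _ _ _.
Hypothesis lrA : forall (g h k gh hk ghk : G)
  (e1 : g * h = gh) (e2 : gh * k = ghk) (e3 : h * k = hk) (e4 : g * hk = ghk),
  r e2 ∘ (l e1 ⊠ cid (aF b k)) = l e4 ∘ (cid (aF a g) ⊠ r e3) ∘ ass _ _ _.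
Hypothesis rA : forall (g h k gh hk ghk : G)
  (e1 : g * h = gh) (e2 : gh * k = ghk) (e3 : h * k = hk) (e4 : g * hk = ghk),
  r e2 ∘ (r e1 ⊠ cid (aF b k)) = r e4 ∘ (cid (D g) ⊠ graded_η b e3) ∘ ass _ _ _.

(** The last branch also catches [true], [false], which [ij] excludes. *)
Definition bimod_ob (i j : bool) (ij : i ==> j) : G -> A :=
  match i, j with false, false => aF a | true, true => aF b | _, _ => D end.

Definition bimod_mul (i j k : bool) (ij : i ==> j) (jk : j ==> k) (ik : i ==> k)
    (g h gh : G) (e : g * h = gh) : hom (bimod_ob ij g ⊗ bimod_ob jk h) (bimod_ob ik gh).
Proof.
move: i j k ij jk ik => [] [] [] // ij jk ik;
  [exact: graded_η | exact: r | exact: l | exact: graded_η].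
Defined.

(** Five colourings survive. If all colours agree, this is the cocycle condition of one action;
    otherwise the colour changes at the first, middle or last factor, giving [rA], [lrA] or [lA]. *)
Lemma bimod_mulA (i j k m : bool) (ij : i ==> j) (jk : j ==> k) (km : k ==> m)
    (ik : i ==> k) (jm : j ==> m) (im : i ==> m) (g h h' gh hk ghk : G)
    (e1 : g * h = gh) (e2 : gh * h' = ghk) (e3 : h * h' = hk) (e4 : g * hk = ghk) :
  bimod_mul ik km im e2 ∘ (bimod_mul ij jk ik e1 ⊠ cid (bimod_ob km h'))
  = bimod_mul ij jm im e4 ∘ (cid (bimod_ob ij g) ⊠ bimod_mul jk km jm e3) ∘ ass _ _ _.
Proof.
move: i j k m ij jk km ik jm im => [] [] [] [] //= *;
  by [exact: graded_ηA | exact: lA | exact: rA | exact: lrA].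
Qed.

Definition bimod_lax : lax G A implb := Lax bimod_mulA.

End Homotopy_of_bimodule.

Lemma bimod_homotopy (G : groupType) (A : cat_group) (φ ψ : smap (BG G) (Bcg A)) D l r
    lA lrA rA :
  homotopy_between φ ψ
    (lax_homotopy (@bimod_lax G A (action_of_map φ) (action_of_map ψ) D l r lA lrA rA)).
Proof.
(* On a constant colour [bimod_ob] and [bimod_mul] compute to the action at that end, so the casts
   are identities. *)
move=> n s; split; unshelve refine (map_simplex _); try by [].
  by move=> i j k ij jk ik; rewrite !idto_id thom1 ccompf1 ccomp1f.
by move=> i j k ij jk ik; rewrite !idto_id thom1 ccompf1 ccomp1f.
Qed.

(** The triangle of [g] and [h] is sent by [Bhom f] to one with edges [f g], [f h] and [f (g * h)],
    on which [map_mulE] reads the multiplication of [φ]; [gmulfM] on the long edge accounts for the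
    cast in [action_pull]. *)
Lemma map_pull (H G : groupType) (A : cat_group) (f : {multiplicative H -> G})
    (φ : smap (BG G) (Bcg A)) :
  action_iso (action_of_map (smap_comp φ (Bhom f))) (action_pull f (action_of_map φ)).
Proof.
pose ψ := smap_comp φ (Bhom f).
have B n (s : BG H n) (i j : 'I_n.+1) (ij : (i <= j)%N) (g : H) :
    nX s ij = g -> nX (sm (Bhom f) s) ij = f g by move=> <-.
have E g : map_ob ψ g = map_ob φ (f g).
  by apply: (map_obj_eq φ (B _ (gedge g) _ _ i01 g _)); rewrite /= invg1 mul1g.
exists (fun g => idto (E g)) => g h /=.
pose s := gtriangle g h.
have b01 := B _ s _ _ _ _ (gtriangle01 g h).
have b12 := B _ s _ _ _ _ (gtriangle12 g h).
have b02 := B _ s _ _ _ _ (gtriangle02 g h); rewrite gmulfM in b02.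
have M := map_mulE (map_obj_eq ψ (gtriangle01 g h)) (map_obj_eq ψ (gtriangle12 g h))
  (map_obj_eq ψ (gtriangle02 g h)) (gtriangle01 g h) (gtriangle12 g h).
have N := map_mulE (map_obj_eq φ b01) (map_obj_eq φ b12) (map_obj_eq φ b02) b01 b12.
apply: (cg_epi (f := idto (map_obj_eq ψ (gtriangle01 g h))
  ⊠ idto (map_obj_eq ψ (gtriangle12 g h)))).
rewrite -[LHS]ccompA -[X in _ ∘ X = _]M -[RHS]ccompA -thomM !idto_comp.
rewrite (idto_irr _ (map_obj_eq φ b01)) (idto_irr (etrans _ (E h)) (map_obj_eq φ b12)).
rewrite -[RHS]ccompA -[X in _ = _ ∘ X]N !ccompA !idto_comp.
by congr (_ ∘ _); exact: idto_irr.
Qed.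

(** * Pointed maps and pointed homotopies *)

Section Pointed.
Variables (G : groupType) (A : cat_group).

(** Naturality of [lun] turns the hypothesis into [cid tunit ⊠ θ = θ ⊠ θ], where the invertible
    [cid tunit ⊠ θ] cancels. *)
Lemma tunit_idem (θ : hom (@tunit A) tunit) :
  θ ∘ lun tunit = lun tunit ∘ (θ ⊠ θ) -> θ = cid tunit.
Proof.
rewrite -lun_nat => /cg_mono e; apply: (@tensr_faithful _ tunit).
apply: (cg_epi (f := cid tunit ⊠ θ)).
by rewrite -!thomM !ccomp1f ccompf1 -e.
Qed.

Lemma pmap_ob1 (φ : pmap (BG G) (Bcg A)) : map_ob φ 1 = tunit.
Proof.
rewrite -(@map_obj _ _ φ _ (pt (BG G)) ord0 ord0 isT).
by rewrite (pm_pt φ).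
Qed.

(** The degenerate triangle at the base point is sent to the one of the nerve, whose multiplication
    is [lun tunit]. *)
Lemma pmap_η1 (φ : pmap (BG G) (Bcg A)) (e : (1 * 1 : G) = 1)
    (c c' c'' : map_ob φ 1 = tunit) :
  idto c ∘ graded_η (action_of_map φ) e = lun tunit ∘ (idto c' ⊠ idto c'').
Proof.
have E := @map_ηE _ _ φ _ (pt (BG G)) ord0 ord0 ord0 isT isT isT.
have X : nX (sm φ (pt (BG G))) (i := ord0) (j := ord0) isT = tunit by rewrite (pm_pt φ).
have T := @nT_transport A _ _ _ (pm_pt φ) ord0 ord0 ord0 isT isT isT isT isT isT X X X.
set m := map_obj φ _ _ in E.
apply: (cg_epi (f := idto m ⊠ idto m)).
rewrite (proof_irrelevance _ e
  (gnerve_mul (pt (BG G)) (i := ord0) (j := ord0) (l := ord0) isT isT isT)).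
rewrite -[LHS]ccompA -[X in _ ∘ X = _]E ccompA idto_comp (idto_irr _ X) [LHS]T.
by rewrite rwl_thom !idto_comp; congr (_ ∘ (_ ⊠ _)); exact: idto_irr.
Qed.

(** The bimodule is the second action itself, on which the first acts on the left through [α]. The
    homotopy is pointed because [α 1] is the identity of the unit object up to casts. *)
Lemma phomotopic_of_iso (φ ψ : pmap (BG G) (Bcg A)) :
  action_iso (action_of_map φ) (action_of_map ψ) -> phomotopic φ ψ.
Proof.
move=> [α αE]; set a := action_of_map φ in α αE; set b := action_of_map ψ in α αE.
have αη g h gh (e : g * h = gh) :
    α gh ∘ graded_η a e = graded_η b e ∘ (α g ⊠ α h).
  by subst gh; rewrite !graded_η1.
pose r g h gh (e : g * h = gh) : hom (aF b g ⊗ aF b h) (aF b gh) := graded_η b e.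
pose l g h gh (e : g * h = gh) : hom (aF a g ⊗ aF b h) (aF b gh) :=
  graded_η b e ∘ (α g ⊠ cid _).
have lA g h k gh hk ghk (e1 : g * h = gh) (e2 : gh * k = ghk) (e3 : h * k = hk)
    (e4 : g * hk = ghk) :
    l _ _ _ e2 ∘ (graded_η a e1 ⊠ cid _) = l _ _ _ e4 ∘ (cid _ ⊠ l _ _ _ e3) ∘ ass _ _ _.
  rewrite /l !rwl_thom !ccomp1f ccompf1 αη.
  rewrite -[in LHS](ccompf1 (cid (aF b k))) thomM ccompA (graded_ηA b e1 e2 e3 e4).
  by rewrite -[LHS]ccompA ass_nat !ccompA rwl_thom ccomp1f.
have lrA g h k gh hk ghk (e1 : g * h = gh) (e2 : gh * k = ghk) (e3 : h * k = hk)
    (e4 : g * hk = ghk) :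
    r _ _ _ e2 ∘ (l _ _ _ e1 ⊠ cid _) = l _ _ _ e4 ∘ (cid _ ⊠ r _ _ _ e3) ∘ ass _ _ _.
  rewrite /l /r !rwl_thom !ccomp1f ccompf1.
  rewrite -[in LHS](ccompf1 (cid (aF b k))) thomM ccompA (graded_ηA b e1 e2 e3 e4).
  by rewrite -[LHS]ccompA ass_nat !ccompA rwl_thom ccomp1f thom1 ccompf1.
apply: rst_step; exists (lax_homotopy (bimod_lax lA lrA (graded_ηA b))).
split=> [|n t]; first exact: bimod_homotopy.
have c (i j : bool) (ij : i ==> j) : @bimod_ob _ _ a b (aF b) i j ij 1 = tunit.
  by move: i j ij => [] [] // ij; [exact: pmap_ob1 | exact: pmap_ob1 | exact: (pmap_ob1 φ)].
(* Read through the casts, [α 1] is an endomorphism of the unit object compatible with [lun tunit],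
   so [tunit_idem] applies. *)
have α1 : idto (pmap_ob1 ψ) ∘ α 1 = idto (pmap_ob1 φ).
  have [i iK] := cg_inv (idto (pmap_ob1 φ)).
  have θ1 : idto (pmap_ob1 ψ) ∘ α 1 ∘ i = cid tunit.
    apply: tunit_idem; apply: (cg_epi (f := idto (pmap_ob1 φ) ⊠ idto (pmap_ob1 φ))).
    have e : (1 * 1 : G) = 1 by exact: mulg1.
    rewrite rwl_thom (rwl iK.1) ccompf1 -ccompA -(pmap_η1 e (pmap_ob1 φ)) ccompA.
    rewrite (rwl iK.1) ccompf1 -ccompA αη ccompA (pmap_η1 e _ (pmap_ob1 ψ) (pmap_ob1 ψ)).
    by rewrite rwl_thom.
  by rewrite -[RHS]ccomp1f -θ1 (rwl iK.1) ccompf1.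
unshelve refine (nerve_eq _); first by move=> i j ij; exact: c.
move=> i j k ij jk ik /=.
move: (colour_le t ij) (colour_le t jk) (colour_le t ik).
move: (colour t i) (colour t j) (colour t k).
move: (gnerve_mul _ _ _ _) => /= e i' j' k'.
(* The mixed triangles over the base point; those of constant colour are covered by [pmap_η1]. *)
have lE (c1 : map_ob φ 1 = tunit) (c2 c3 : map_ob ψ 1 = tunit) :
    idto c3 ∘ l 1 1 1 e = lun tunit ∘ (idto c1 ⊠ idto c2).
  rewrite /l ccompA (pmap_η1 e c3 c3 c2) rwl_thom ccompf1.
  by rewrite (idto_irr c3 (pmap_ob1 ψ)) α1 (idto_irr c1 (pmap_ob1 φ)).
move: i' j' k' => [] [] [] //= x y z; by [exact: pmap_η1 | exact: lE].
Qed.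

Section Transport.
Variables (a : action G A) (X : G -> A) (α : forall g, hom (X g) (aF a g)).

(** Carrying the multiplication along [α] allows replacing the object at [1] by [tunit] itself, as a
    pointed map demands. *)
Definition transport_η (g h k : G) (e : g * h = k) : hom (X g ⊗ X h) (X k) :=
  sval (cg_divl (α k) (graded_η a e ∘ (α g ⊠ α h))).

Lemma transport_ηE (g h k : G) (e : g * h = k) :
  α k ∘ transport_η e = graded_η a e ∘ (α g ⊠ α h).
Proof. exact: svalP (cg_divl _ _). Qed.

Lemma transport_ηA (g h k gh hk ghk : G) (e1 : g * h = gh) (e2 : gh * k = ghk)
    (e3 : h * k = hk) (e4 : g * hk = ghk) :
  transport_η e2 ∘ (transport_η e1 ⊠ cid (X k))
  = transport_η e4 ∘ (cid (X g) ⊠ transport_η e3) ∘ ass (X g) (X h) (X k).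
Proof.
apply: (cg_mono (f := α ghk)).
rewrite !ccompA !transport_ηE !rwl_thom !ccompf1 !transport_ηE.
rewrite -[in LHS](ccomp1f (α k)) -[in RHS](ccomp1f (α g)) !thomM !ccompA.
by rewrite (graded_ηA a e1 e2 e3 e4) -[LHS]ccompA ass_nat ccompA.
Qed.

Definition transport_lax : lax G A (fun _ _ : unit => true) :=
  @Lax G A unit (fun _ _ => true) (fun _ _ _ => X)
    (fun _ _ _ _ _ _ => transport_η)
    (fun _ _ _ _ _ _ _ _ _ _ => transport_ηA).

End Transport.

(** Replace [aF a 1] by [tunit] along the unit [u] of the action; the transported multiplication at
    [1] is then [lun tunit], and the map of the new lax functor preserves base points strictly. *)
Lemma pmap_of_action (a : action G A) :
  exists φ : pmap (BG G) (Bcg A), action_iso (action_of_map φ) a.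
Proof.
have [u uL] : exists u : hom tunit (aF a 1), forall e : (1 * 1 : G) = 1,
    graded_η a e ∘ (u ⊠ cid _) = lun (aF a 1).
  have [u [uL _]] := lax_unit (action_lax a) (i := tt) isT (erefl 1).
  by exists u => e; exact: (uL tt isT).
pose X g := if g == 1 then tunit else aF a g.
have X1 : X 1 = tunit by rewrite /X eqxx.
(* The casts give one statement for both outcomes of [g == 1]: the isomorphism is [u] at [1] and an
   identity elsewhere. *)
have α g : { f : hom (X g) (aF a g) |
    forall (e : tunit = X g) (e' : g = 1), f ∘ idto e = idto (f_equal (aF a) (esym e')) ∘ u }.
  rewrite /X; case: eqVneq => [->|/eqP g1]; last by exists (cid _) => e e'; case: (g1 e').
  by exists u => e e'; rewrite !idto_id ccomp1f ccompf1.
pose L := transport_lax (fun g => sval (α g)).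
have pt1 : sm (lax_map L) (pt (BG G)) = pt (Bcg A).
  unshelve refine (nerve_eq _); first by move=> i j ij; exact: X1.
  move=> i j k ij jk ik /=; move: (gnerve_mul _ _ _ _) => /= e.
  have αu : sval (α 1) = u ∘ idto X1.
    have := svalP (α 1) (esym X1) erefl; rewrite idto_id ccomp1f.
    by move=> /(f_equal (fun f => f ∘ idto X1)); rewrite -ccompA idto_comp idto_id ccompf1.
  (* After composing with [u], the claim follows from the unit law [uL] and naturality of [lun]. *)
  apply: (cg_mono (f := u)); rewrite ccompA -αu transport_ηE αu thomM ccompA.
  have -> : u ⊠ u = (u ⊠ cid _) ∘ (cid _ ⊠ u) by rewrite -thomM ccomp1f ccompf1.
  by rewrite ccompA uL lun_nat -ccompA.
exists (PMap pt1); apply: action_iso_trans (lax_map_action L) _.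
exists (fun g => sval (α g)) => g h.
by rewrite /= transport_ηE graded_η1.
Qed.

End Pointed.

(** * Conjugations of actions by autoequivalences, in components *)

Section Autoequivalence_actions.
Variables (M : moncat) (Pr : monfunctor M M -> Prop).
Hypothesis P_id : Pr (mfid M).
Hypothesis P_comp : forall F F', Pr F -> Pr F' -> Pr (mfcomp F F').
Hypothesis P_inv : forall F F', Pr F -> is_equivalence F ->
  moniso (mfcomp F F') (mfid M) -> Pr F'.
Local Notation A := (autoeq_group P_id P_comp P_inv).
Variable G : groupType.

Definition fn (F : A) : functor M M := mfun (sval F).

Definition cmp (F F' : A) (f : hom F F') (x : M) : hom (fn F x) (fn F' x) :=
  mt (f : moniso (sval F) (sval F')) x.

Lemma cmp_eq (F F' : A) (f f' : hom F F') : (forall x, cmp f x = cmp f' x) -> f = f'.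
Proof. exact: moniso_eq. Qed.

Lemma cmp_id (F : A) x : cmp (cid F) x = cid (fn F x). Proof. by []. Qed.

Lemma cmp_comp (F F' F'' : A) (f' : hom F' F'') (f : hom F F') x :
  cmp (f' ∘ f) x = cmp f' x ∘ cmp f x.
Proof. by []. Qed.

Lemma cmp_thom (F F' H H' : A) (f : hom F F') (h : hom H H') x :
  cmp (f ⊠ h) x = cmp f (fn H' x) ∘ fhom (fn F) (cmp h x).
Proof. by []. Qed.

Lemma cmp_ass (F F' F'' : A) x : cmp (ass F F' F'') x = cid (fn F (fn F' (fn F'' x))).
Proof. by []. Qed.

Lemma cmp_lun (F : A) x : cmp (lun F) x = cid (fn F x). Proof. by []. Qed.

Lemma cmp_run (F : A) x : cmp (run F) x = cid (fn F x). Proof. by []. Qed.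

Lemma cmp_assV (F F' F'' : A) ai x : is_inverse (ass F F' F'') ai ->
  cmp ai x = cid (fn F (fn F' (fn F'' x))).
Proof. by move=> [/(f_equal (fun m => cmp m x))]; rewrite cmp_comp cmp_ass ccompf1. Qed.

Lemma cmp_nat (F F' : A) (f : hom F F') (x y : M) (m : hom x y) :
  cmp f y ∘ fhom (fn F) m = fhom (fn F') m ∘ cmp f x.
Proof. exact: (mt_nat (f : moniso (sval F) (sval F'))). Qed.

Lemma cmp_iso (F F' : A) (f : hom F F') x : is_iso (cmp f x).
Proof. exact: mt_iso. Qed.

Implicit Types a b c : action G A.

(** The type names iterated functors in place of a tensor product of autoequivalences; the later
    [change] steps bring goals to this form so that functoriality can be rewritten with. *)
Definition cη a (g h k : G) (e : g * h = k) (x : M) :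
    hom (fn (aF a g) (fn (aF a h) x)) (fn (aF a k) x) :=
  cmp (graded_η a e) x.

Lemma cηE a (g h k : G) (e : g * h = k) (x : M) : cη a e x = cmp (graded_η a e) x.
Proof. by []. Qed.

Lemma cη_nat a (g h k : G) (e : g * h = k) (x y : M) (m : hom x y) :
  cη a e y ∘ fhom (fn (aF a g)) (fhom (fn (aF a h)) m) = fhom (fn (aF a k)) m ∘ cη a e x.
Proof. rewrite !cηE; exact: (cmp_nat (graded_η a e) m). Qed.

Lemma cηA a (g h k gh hk ghk : G) (e1 : g * h = gh) (e2 : gh * k = ghk)
    (e3 : h * k = hk) (e4 : g * hk = ghk) (x : M) :
  cη a e2 x ∘ cη a e1 (fn (aF a k) x) = cη a e4 x ∘ fhom (fn (aF a g)) (cη a e3 x).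
Proof.
have := f_equal (fun m => cmp m x) (graded_ηA a e1 e2 e3 e4).
by rewrite !cηE !(cmp_comp, cmp_thom, cmp_ass, cmp_id, fhom1, ccompf1, ccomp1f).
Qed.

Definition cβ (Q F F' : A) (β : hom (Q ⊗ F) (F' ⊗ Q)) (x : M) :
  hom (fn Q (fn F x)) (fn F' (fn Q x)) := cmp β x.

Lemma cβ_nat (Q F F' : A) (β : hom (Q ⊗ F) (F' ⊗ Q)) (x y : M) (m : hom x y) :
  cβ β y ∘ fhom (fn Q) (fhom (fn F) m) = fhom (fn F') (fhom (fn Q) m) ∘ cβ β x.
Proof. exact: (cmp_nat β m). Qed.

Lemma cβE (Q F F' : A) (β : hom (Q ⊗ F) (F' ⊗ Q)) (x : M) : cβ β x = cmp β x.
Proof. by []. Qed.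

Definition conj_cmp (Q : A) a b (β : forall g, hom (Q ⊗ aF a g) (aF b g ⊗ Q)) : Prop :=
  forall g h k (e : g * h = k) (x : M),
    cβ (β k) x ∘ fhom (fn Q) (cη a e x)
    = cη b e (fn Q x) ∘ fhom (fn (aF b g)) (cβ (β h) x) ∘ cβ (β g) (fn (aF a h) x).

(** Associators and their inverses have identity components and drop out. *)
Lemma conj_byE (Q : A) a b : conj_by Q a b <-> exists β, @conj_cmp Q a b β.
Proof.
split=> -[β βE]; exists β; [move=> g h k e x | move=> g h ai aiK].
  subst k; rewrite !cηE !graded_η1.
  have [ai aiK] := cg_inv (ass (aF b g) (aF b h) Q).
  move: (βE g h ai aiK) => /(f_equal (fun m => cmp m x)).
  rewrite !(cmp_comp, cmp_thom, cmp_ass, cmp_assV _ aiK, cmp_id, fhom1, ccompf1, ccomp1f).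
  by [].
apply: cmp_eq => x.
rewrite !(cmp_comp, cmp_thom, cmp_ass, cmp_assV _ aiK, cmp_id, fhom1, ccompf1, ccomp1f).
by have := βE g h _ erefl x; rewrite !cηE !graded_η1.
Qed.

Lemma action_conj_trans a b c : action_conj a b -> action_conj b c -> action_conj a c.
Proof.
move=> [Q /conj_byE [β βE]] [R /conj_byE [γ γE]].
exists (R ⊗ Q); apply/conj_byE.
(* Move the action first past [Q] by [β], then past [R] by [γ]. *)
pose δ g : hom ((R ⊗ Q) ⊗ aF a g) (aF c g ⊗ (R ⊗ Q)) :=
  ass _ _ _ ∘ (γ g ⊠ cid Q) ∘ sval (cg_inv (ass _ _ _)) ∘ (cid R ⊠ β g) ∘ ass _ _ _.
have δE g x : cmp (δ g) x = cβ (γ g) (fn Q x) ∘ fhom (fn R) (cβ (β g) x).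
  rewrite /δ; case: cg_inv => ai aiK.
  by rewrite !(cmp_comp, cmp_thom, cmp_ass, cmp_assV _ aiK, cmp_id, fhom1, ccompf1, ccomp1f).
exists δ => g h k e x; rewrite !cβE !δE.
change (cβ (γ k) (fn Q x) ∘ fhom (fn R) (cβ (β k) x) ∘ fhom (fn R) (fhom (fn Q) (cη a e x))
  = cη c e (fn R (fn Q x))
    ∘ fhom (fn (aF c g)) (cβ (γ h) (fn Q x) ∘ fhom (fn R) (cβ (β h) x))
    ∘ (cβ (γ g) (fn Q (fn (aF a h) x)) ∘ fhom (fn R) (cβ (β g) (fn (aF a h) x)))).
rewrite -[LHS]ccompA -[X in _ ∘ X = _]fhomM βE 3!fhomM !ccompA γE.
rewrite -(ccompA _ (cβ (γ g) _)) cβ_nat.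
by rewrite !ccompA.
Qed.

Lemma conj_of_iso a b : action_iso a b -> action_conj a b.
Proof.
move=> [α αE]; exists tunit; apply/conj_byE.
pose β g : hom (tunit ⊗ aF a g) (aF b g ⊗ tunit) :=
  sval (cg_inv (run (aF b g))) ∘ α g ∘ lun (aF a g).
have βE g x : cmp (β g) x = cmp (α g) x.
  rewrite /β; case: cg_inv => i iK; have := f_equal (fun m => cmp m x) iK.2.
  by rewrite !cmp_comp cmp_run cmp_id ccomp1f => ->; rewrite cmp_lun ccompf1 ccomp1f.
exists β => g h k e x; subst k; rewrite !cβE !βE !cηE !graded_η1.
have := f_equal (fun m => cmp m x) (αE g h).
rewrite !(cmp_comp, cmp_thom) (cmp_nat (α g)) => E.
by rewrite -[RHS]ccompA; exact: E.
Qed.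

(** Insert [Q] by [p], apply [β g], and remove [Q] by the inverse [q] of [p]; in the product of two
    such maps the inner [q] and [p] cancel. *)
Lemma iso_of_conj_by (Q : A) a b : hom tunit Q -> conj_by Q a b -> action_iso a b.
Proof.
move=> p /conj_byE [β βE]; have [q [_ pq]] := cg_inv p.
pose cp x : hom x (fn Q x) := cmp p x.
pose cq x : hom (fn Q x) x := cmp q x.
have cpq x : cp x ∘ cq x = cid (fn Q x) := f_equal (fun m => cmp m x) pq.
have cp_nat x y (m : hom x y) : cp y ∘ m = fhom (fn Q) m ∘ cp x := cmp_nat p m.
pose cα g x : hom (fn (aF a g) x) (fn (aF b g) x) :=
  fhom (fn (aF b g)) (cq x) ∘ cβ (β g) x ∘ cp (fn (aF a g) x).
have [α αE] : exists α : forall g, hom (aF a g) (aF b g),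
    forall g x, cmp (α g) x = cα g x.
  exists (fun g => run _ ∘ (cid _ ⊠ q) ∘ β g ∘ (p ⊠ cid _) ∘ sval (cg_inv (lun _))).
  move=> g x.
  case: cg_inv => i iK; have := f_equal (fun m => cmp m x) iK.2.
  rewrite !(cmp_comp, cmp_thom, cmp_id, cmp_lun, cmp_run, fhom1, ccomp1f, ccompf1) => ->.
  by rewrite ccompf1.
exists α => g h; apply: cmp_eq => x; rewrite !(cmp_comp, cmp_thom) (cmp_nat (α g)) !αE.
rewrite -!graded_η1 -!cηE.
change (cα (g * h) x ∘ cη a (erefl (g * h)) x
  = cη b (erefl (g * h)) x ∘ (fhom (fn (aF b g)) (cα h x) ∘ cα g (fn (aF a h) x))).
rewrite /cα !ccompA (rwl (cp_nat _ _ (cη a (erefl (g * h)) x))) !ccompA.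
rewrite (rwl (βE g h _ erefl x)) !ccompA -cη_nat.
rewrite 2!fhomM !ccompA -(ccompA _ _ (fhom _ (cq _))) -fhomM cpq fhom1 ccompf1.
by [].
Qed.

(** Conjugate back by an inverse [R] of [Q]. The map [β' g] is the mate of [β g] under [e], which
    exists because tensoring with [Q] is full. *)
Lemma action_conj_sym a b : action_conj a b -> action_conj b a.
Proof.
move=> [Q /conj_byE [β βE]].
have [R [[e _] _]] := cg_invertible Q.
pose ce x : hom (fn Q (fn R x)) x := cmp e x.
have ce_nat x y (m : hom x y) : ce y ∘ fhom (fn Q) (fhom (fn R) m) = m ∘ ce x := cmp_nat e m.
have [β' β'E] : exists β' : forall g, hom (R ⊗ aF b g) (aF a g ⊗ R), forall g x,
    fhom (fn (aF b g)) (ce x) ∘ cβ (β g) (fn R x) ∘ fhom (fn Q) (cβ (β' g) x)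
    = ce (fn (aF b g) x).
  have K g : { β' : hom (R ⊗ aF b g) (aF a g ⊗ R) |
      forall x, fhom (fn (aF b g)) (ce x) ∘ cβ (β g) (fn R x) ∘ fhom (fn Q) (cβ β' x)
        = ce (fn (aF b g) x) }.
    apply: constructive_indefinite_description.
    have [i iK] := cg_inv (ass Q (aF a g) R).
    have [j jK] := cg_inv (ass Q R (aF b g)).
    have [m mE] := cg_divl (run _ ∘ (cid (aF b g) ⊠ e) ∘ ass _ _ _ ∘ (β g ⊠ cid R) ∘ i)
      (lun _ ∘ (e ⊠ cid (aF b g)) ∘ j).
    have [β' β'm] := tensl_full m; exists β' => x.
    have := f_equal (fun m => cmp m x) mE; rewrite -β'm.
    rewrite !(cmp_comp, cmp_thom, cmp_id, cmp_ass, cmp_assV _ iK, cmp_assV _ jK, cmp_lun,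
      cmp_run, fhom1, ccomp1f, ccompf1).
    by [].
  by exists (fun g => sval (K g)) => g; exact: (svalP (K g)).
exists R; apply/conj_byE; exists β' => g h k e1 x.
(* As [Q] is faithful and the maps in [β'E] are invertible, the identity may be checked where [β'E]
   eliminates [β']. *)
have [F' [[d [d_iso d_nat]] _]] := (svalP Q).2.
apply: (equiv_faithful (F := sval Q) (G := F') d_iso d_nat).
have i1 : is_iso (fhom (fn (aF b k)) (ce x) ∘ cβ (β k) (fn R x)).
  by apply: comp_iso; [apply: fhom_iso; exact: (cmp_iso e x) | exact: (cmp_iso (β k) (fn R x))].
apply: (iso_mono i1).
change (fhom (fn (aF b k)) (ce x) ∘ cβ (β k) (fn R x) ∘
    fhom (fn Q) (cβ (β' k) x ∘ fhom (fn R) (cη b e1 x))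
  = fhom (fn (aF b k)) (ce x) ∘ cβ (β k) (fn R x) ∘
    fhom (fn Q) (cη a e1 (fn R x) ∘ fhom (fn (aF a g)) (cβ (β' h) x)
      ∘ cβ (β' g) (fn (aF b h) x))).
rewrite 3!fhomM !ccompA β'E ce_nat (rwl (βE _ _ _ e1 _)) !ccompA -cη_nat.
rewrite (rwl (cβ_nat _ _)) !ccompA -!(ccompA (cη b e1 x)) -!fhomM.
by rewrite !β'E.
Qed.

(** The objects [Q ⊗ aF a g] carry a right action of [a] by [η] and a left action of [b] through the
    inverse of [β]. The left end is therefore [ψ], whence the initial symmetry. *)
Lemma homotopic_of_conj (φ ψ : smap (BG G) (Bcg A)) :
  action_conj (action_of_map φ) (action_of_map ψ) -> homotopic φ ψ.
Proof.
move=> [Q /conj_byE [β βE]]; apply: rst_sym; apply: rst_step.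
set a := action_of_map φ in β βE; set b := action_of_map ψ in β βE.
pose D g : A := Q ⊗ aF a g.
have [r rE] : exists r : forall g h k, g * h = k -> hom (D g ⊗ aF a h) (D k),
    forall g h k (e : g * h = k) x, cmp (r _ _ _ e) x = fhom (fn Q) (cη a e x).
  exists (fun g h k e => (cid Q ⊠ graded_η a e) ∘ ass _ _ _) => g h k e x.
  by rewrite !(cmp_comp, cmp_thom, cmp_ass, cmp_id, ccompf1, ccomp1f) cηE.
have [l lE] : exists l : forall g h k, g * h = k -> hom (aF b g ⊗ D h) (D k),
    forall g h k (e : g * h = k) x,
      cmp (l _ _ _ e) x ∘ cβ (β g) (fn (aF a h) x) = fhom (fn Q) (cη a e x).
  exists (fun g h k e => r g h k e ∘ (sval (cg_inv (β g)) ⊠ cid _) ∘ sval (cg_inv (ass _ _ _))).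
  move=> g h k e x; case: cg_inv => i iK; case: cg_inv => j jK.
  rewrite !(cmp_comp, cmp_thom, cmp_assV _ jK, cmp_id, fhom1, ccompf1) -rE.
  have := f_equal (fun m => cmp m (fn (aF a h) x)) iK.1.
  rewrite cmp_comp cmp_id => E.
  by rewrite -[RHS]ccompf1 -[LHS]ccompA; congr (_ ∘ _); exact: E.
pose cl g h k (e : g * h = k) x :
  hom (fn (aF b g) (fn Q (fn (aF a h) x))) (fn Q (fn (aF a k) x)) := cmp (l _ _ _ e) x.
have clE g h k (e : g * h = k) x :
  cl _ _ _ e x ∘ cβ (β g) (fn (aF a h) x) = fhom (fn Q) (cη a e x) := lE _ _ _ e x.
have lA g h k gh hk ghk (e1 : g * h = gh) (e2 : gh * k = ghk) (e3 : h * k = hk)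
    (e4 : g * hk = ghk) :
    l _ _ _ e2 ∘ (graded_η b e1 ⊠ cid _) = l _ _ _ e4 ∘ (cid _ ⊠ l _ _ _ e3) ∘ ass _ _ _.
  apply: cmp_eq => x; rewrite !(cmp_comp, cmp_thom, cmp_ass, cmp_id, fhom1, ccompf1, ccomp1f).
  pose y := fn (aF a k) x.
  (* Precomposing with this isomorphism replaces every [l] by [η], through [clE], and leaves the
     associativity [cηA]. *)
  have i1 : is_iso (fhom (fn (aF b g)) (cβ (β h) y) ∘ cβ (β g) (fn (aF a h) y)).
    by apply: comp_iso; [apply: fhom_iso; exact: (cmp_iso (β h) y) | exact: (cmp_iso (β g) _)].
  apply: (iso_epi i1).
  change (cl _ _ _ e2 x ∘ cη b e1 (fn Q y)
      ∘ (fhom (fn (aF b g)) (cβ (β h) y) ∘ cβ (β g) (fn (aF a h) y))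
    = cl _ _ _ e4 x ∘ fhom (fn (aF b g)) (cl _ _ _ e3 x)
      ∘ (fhom (fn (aF b g)) (cβ (β h) y) ∘ cβ (β g) (fn (aF a h) y))).
  rewrite -[LHS]ccompA (ccompA (cη _ _ _)) -βE ccompA clE -fhomM (cηA a e1 e2 e3 e4) fhomM.
  rewrite [RHS]ccompA -(ccompA (cl _ _ _ e4 x)) -(fhomM (fn (aF b g))) clE.
  rewrite -(ccompA (cl _ _ _ e4 x)) -cβ_nat.
  by rewrite ccompA clE.
have lrA g h k gh hk ghk (e1 : g * h = gh) (e2 : gh * k = ghk) (e3 : h * k = hk)
    (e4 : g * hk = ghk) :
    r _ _ _ e2 ∘ (l _ _ _ e1 ⊠ cid _) = l _ _ _ e4 ∘ (cid _ ⊠ r _ _ _ e3) ∘ ass _ _ _.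
  apply: cmp_eq => x; rewrite !(cmp_comp, cmp_thom, cmp_ass, cmp_id, fhom1, ccompf1, ccomp1f).
  rewrite !rE; apply: (iso_epi (cmp_iso (β g) (fn (aF a h) (fn (aF a k) x)))).
  change (fhom (fn Q) (cη a e2 x) ∘ cl _ _ _ e1 (fn (aF a k) x)
      ∘ cβ (β g) (fn (aF a h) (fn (aF a k) x))
    = cl _ _ _ e4 x ∘ fhom (fn (aF b g)) (fhom (fn Q) (cη a e3 x))
      ∘ cβ (β g) (fn (aF a h) (fn (aF a k) x))).
  rewrite -[LHS]ccompA clE -fhomM (cηA a e1 e2 e3 e4) fhomM -[RHS]ccompA -cβ_nat.
  by rewrite ccompA clE.
have rA g h k gh hk ghk (e1 : g * h = gh) (e2 : gh * k = ghk) (e3 : h * k = hk)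
    (e4 : g * hk = ghk) :
    r _ _ _ e2 ∘ (r _ _ _ e1 ⊠ cid _) = r _ _ _ e4 ∘ (cid _ ⊠ graded_η a e3) ∘ ass _ _ _.
  apply: cmp_eq => x; rewrite !(cmp_comp, cmp_thom, cmp_ass, cmp_id, fhom1, ccompf1, ccomp1f).
  rewrite !rE -cηE.
  change (fhom (fn Q) (cη a e2 x) ∘ fhom (fn Q) (cη a e1 (fn (aF a k) x))
    = fhom (fn Q) (cη a e4 x) ∘ fhom (fn Q) (fhom (fn (aF a g)) (cη a e3 x))).
  by rewrite -!fhomM (cηA a e1 e2 e3 e4).
by exists (lax_homotopy (bimod_lax lA lrA rA)); exact: bimod_homotopy.
Qed.

Lemma homotopy_conj (φ ψ : smap (BG G) (Bcg A)) h :
  homotopy_between φ ψ h -> action_conj (action_of_map φ) (action_of_map ψ).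
Proof.
move=> hE; have [ii [jj ij]] : ((@ord0 1 <= @ord0 1) /\ (@ord_max 1 <= @ord_max 1)
  /\ (@ord0 1 <= @ord_max 1))%N by [].
(* [lax_conj] conjugates the action at the end [1] into the one at the end [0], opposite to the
   direction claimed. *)
apply: action_conj_sym.
have /conj_of_iso C1 := hom_lax_end jj (fun n s => (hE n s).2).
have /conj_of_iso C0 := hom_lax_end ii (fun n s => (hE n s).1).
apply: action_conj_trans C0; apply: action_conj_trans (action_conj_sym C1) _.
exists (lX (hom_lax h) ij 1); exact: lax_conj.
Qed.

Lemma phomotopy_iso (φ ψ : smap (BG G) (Bcg A)) h :
  homotopy_between φ ψ h ->
  (forall n (t : std_simplex 1 n), sm h (ptn (BG G) n, t) = ptn (Bcg A) n) ->
  action_iso (action_of_map φ) (action_of_map ψ).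
Proof.
move=> hE hpt; have [ii [jj ij]] : ((@ord0 1 <= @ord0 1) /\ (@ord_max 1 <= @ord_max 1)
  /\ (@ord0 1 <= @ord_max 1))%N by [].
apply: action_iso_trans (action_iso_sym (hom_lax_end ii (fun n s => (hE n s).1))) _.
apply: action_iso_trans _ (hom_lax_end jj (fun n s => (hE n s).2)).
(* The conjugating object lies on the edge of the prism along the base point, where a pointed
   homotopy is constant. *)
have E : hom_ob h ij 1 = tunit.
  have := @hom_obE _ _ h _ (ptn (BG G) 1) (om_edge ij) ord0 ord_max isT.
  rewrite hpt /= => ->; congr (hom_ob h _ _); exact: bool_irrelevance.
apply: action_iso_sym.
exact: (iso_of_conj_by (idto (esym E)) (lax_conj (hom_lax h) ii jj ij)).
Qed.

Theorem actions_of_autoequivalences_classified : actions_classified_by_maps G A.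
Proof.
split; [split | split |].
- move=> φ ψ; split; last exact: phomotopic_of_iso.
  (* Induction on the closure: one homotopy is the base case, and the others use that [action_iso]
     is an equivalence relation. *)
  elim=> {φ ψ} [φ ψ [h [hE hpt]]|φ|φ ψ _|φ ψ χ _ I1 _ I2].
  + exact: (phomotopy_iso hE hpt).
  + exact: action_iso_refl.
  + exact: action_iso_sym.
  + exact: (action_iso_trans I1 I2).
- exact: pmap_of_action.
- move=> φ ψ; split; last exact: homotopic_of_conj.
  elim=> {φ ψ} [φ ψ [h hE]|φ|φ ψ _|φ ψ χ _ I1 _ I2].
  + exact: (homotopy_conj hE).
  + by apply: conj_of_iso; exact: action_iso_refl.
  + exact: action_conj_sym.
  + exact: (action_conj_trans I1 I2).
- by move=> a; have [φ φa] := pmap_of_action a; exists φ; exact: conj_of_iso.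
by move=> H f φ; exact: map_pull.
Qed.

End Autoequivalence_actions.

Theorem proposition7p8 (k : closedFieldType) (k_char0 : [pchar k]%R =i pred0)
    (G : groupType) :
  (forall C : fusion_cat k, actions_classified_by_maps G (Eq C)) /\
  (forall B : braided_fusion_cat k, actions_classified_by_maps G (EqBr B)).
Proof.
by split=> C; exact: actions_of_autoequivalences_classified.
Qed.
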